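(* Let $N\ge3$, let $\Omega$ be a cone in $\mathbb{R}^N$ or an open domain in $\mathbb{R}^N$ with $0\notin\overline\Omega$, and let $s\in(0,2)$, $\alpha>1$, $\beta>1$, $\alpha+\beta=2^*(s)$, $\lambda,\mu>0$. Assume $\kappa\le0$. Then $$S_{\alpha,\beta,\lambda,\mu}(\Omega)=\big(\max\{\lambda,\mu\}\big)^{-\frac2{2^*(s)}}\mu_s(\Omega).$$ In particular, in this case $S_{\alpha,\beta,\lambda,\mu}(\Omega)$ can only be attained by the semi-trivial pairs: $(U,0)$ if $\lambda>\mu$; $(0,U)$ if $\lambda<\mu$; $(U,0)$ or $(0,U)$ if $\lambda=\mu$; where $U$ is an extremal function of $\mu_s(\Omega)$. Hence the ground state of the problem $$-\Delta u-\lambda\frac{|u|^{2^*(s)-2}u}{|x|^s}=\kappa\alpha\frac{|u|^{\alpha-2}u|v|^\beta}{|x|^s},\qquad -\Delta v-\mu\frac{|v|^{2^*(s)-2}v}{|x|^s}=\kappa\beta\frac{|u|^{\alpha}|v|^{\beta-2}v}{|x|^s}\quad\text{in }\Omega,\quad (u,v)\in D_0^{1,2}(\Omega)\times D_0^{1,2}(\Omega),$$ can only be attained by semi-trivial pairs.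
   Context: $2^*(s):=\frac{2(N-s)}{N-2}$. A cone in $\mathbb{R}^N$ is an open domain $\Omega$ with Lipschitz boundary such that $tx\in\Omega$ for every $t>0$, $x\in\Omega$. $D_0^{1,2}(\Omega)$ is the completion of $C_c^\infty(\Omega)$ in the norm $(\int_\Omega|\nabla u|^2dx)^{1/2}$; $\mathcal{D}:=D_0^{1,2}(\Omega)\times D_0^{1,2}(\Omega)$. $$S_{\alpha,\beta,\lambda,\mu}(\Omega):=\inf_{(u,v)\in\widetilde{\mathcal{D}}}\frac{\int_\Omega(|\nabla u|^2+|\nabla v|^2)dx}{\Big(\int_\Omega\big(\lambda\frac{|u|^{2^*(s)}}{|x|^s}+\mu\frac{|v|^{2^*(s)}}{|x|^s}+2^*(s)\kappa\frac{|u|^\alpha|v|^\beta}{|x|^s}\big)dx\Big)^{2/2^*(s)}},$$ where $\widetilde{\mathcal{D}}$ is the set of $(u,v)\in\mathcal{D}$ for which the integral in the denominator is positive. $\mu_s(\Omega):=\inf\{\int_\Omega|\nabla u|^2dx\,/\,(\int_\Omega|u|^{2^*(s)}|x|^{-s}dx)^{2/2^*(s)}:u\in D_0^{1,2}(\Omega)\setminus\{0\}\}$. A pair is semi-trivial if exactly one of its components is zero. A ground state of the system is a minimizer of $\Phi(u,v)=\frac12\int_\Omega(|\nabla u|^2+|\nabla v|^2)dx-\frac1{2^*(s)}\int_\Omega|x|^{-s}[\lambda|u|^{2^*(s)}+\mu|v|^{2^*(s)}+2^*(s)\kappa|u|^\alpha|v|^\beta]dx$ on $\{(u,v)\in\mathcal{D}\setminus\{(0,0)\}:\langle\Phi'(u,v),(u,v)\rangle=0\}$.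 *)

(* Defs.v *)
From HB Require Import structures.
From mathcomp Require Import all_boot all_order all_algebra.
From mathcomp Require Import all_classical all_reals all_analysis.
Set Implicit Arguments.
Unset Strict Implicit.
Unset Printing Implicit Defensive.
Import Order.TTheory GRing.Theory Num.Theory.
Import numFieldNormedType.Exports.
Local Open Scope classical_set_scope.
Local Open Scope ring_scope.

Definition mx_display : measure_display -> measure_display.
Proof. exact. Qed.

Section mx_measurable.
Context (R : realType) (m n : nat).

Definition mx_cylinders : set (set 'M[R]_(m, n)) :=
  [set A | exists i j, exists2 B : set R, measurable B &
           A = (fun M : 'M[R]_(m, n) => M i j) @^-1` B].

Let mx_set0 : <<s mx_cylinders >> set0.
Proof. exact: sigma_algebra0. Qed.

Let mx_setC A : <<s mx_cylinders >> A -> <<s mx_cylinders >> (~` A).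
Proof. exact: sigma_algebraC. Qed.

Let mx_bigcup (F : (set 'M[R]_(m, n))^nat) :
  (forall i, <<s mx_cylinders >> (F i)) -> <<s mx_cylinders >> (\bigcup_i F i).
Proof. exact: sigma_algebra_bigcup. Qed.

HB.instance Definition _ := @isMeasurable.Build
  (mx_display default_measure_display)
  'M[R]_(m, n) <<s mx_cylinders >> mx_set0 mx_setC mx_bigcup.

Lemma measurable_coord i j :
  measurable_fun [set: 'M[R]_(m, n)] (fun M : 'M[R]_(m, n) => M i j).
Proof.
move=> _ B mB; rewrite setTI; apply: sub_sigma_algebra.
by exists i, j, B.
Qed.

Lemma measurable_fun_mxP d (T : measurableType d) (f : T -> 'M[R]_(m, n)) :
  (forall i j, measurable_fun [set: T] (fun t => f t i j)) ->
  measurable_fun [set: T] f.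
Proof.
move=> mf; apply: (@measurability _ _ _ _ setT f mx_cylinders) => //.
move=> _ [_ [i [j [B mB ->]]] <-]; exact: mf.
Qed.

End mx_measurable.

Section lebesgue_rV.
Context (R : realType).

Definition rV_cons n (p : R * 'rV[R]_n) : 'rV[R]_(n.+1) :=
  \row_(i < n.+1) oapp (p.2 0) p.1 (unlift ord0 i).

Lemma measurable_rV_cons n : measurable_fun [set: R * 'rV[R]_n] (@rV_cons n).
Proof.
apply: measurable_fun_mxP => i j.
case: (unliftP ord0 j) => [k ->|->].
- rewrite (_ : (fun _ => _) = (fun M : 'rV[R]_n => M 0 k) \o snd).
    by apply: measurableT_comp => //; exact: measurable_coord.
  by apply/funext => p /=; rewrite mxE liftK.
- rewrite (_ : (fun _ => _) = fst) //.
  by apply/funext => p /=; rewrite mxE unlift_none.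
Qed.

Definition rV_uncons n (v : 'rV[R]_(n.+1)) : R * 'rV[R]_n :=
  (v 0 ord0, \row_j v 0 (lift ord0 j)).

Lemma rV_consK n : cancel (@rV_cons n) (@rV_uncons n).
Proof.
move=> [x v]; congr (_, _); first by rewrite mxE unlift_none.
by apply/rowP => j; rewrite !mxE liftK.
Qed.

Lemma measurable_rV_uncons n :
  measurable_fun [set: 'rV[R]_(n.+1)] (@rV_uncons n).
Proof.
apply/measurable_fun_pairP; split; first exact: measurable_coord.
apply: measurable_fun_mxP => i j.
rewrite (_ : (fun _ => _) = fun M : 'rV[R]_(n.+1) => M 0 (lift ord0 j)).
  exact: measurable_coord.
by apply/funext => M /=; rewrite mxE.
Qed.

Section lebesgue_step.
Context (n : nat) (mu : {sigma_finite_measure set 'rV[R]_n -> \bar R}).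

Definition lebesgue_step : set 'rV[R]_(n.+1) -> \bar R :=
  pushforward (lebesgue_measure \x mu)%E (@rV_cons n).

Let nu : {measure set 'rV[R]_(n.+1) -> \bar R} :=
  measure_function_pushforward__canonical__measure_function_Measure
    ((lebesgue_measure \x mu)%E : {measure set (measurableTypeR R * _) -> \bar R})
    (@measurable_rV_cons n).

HB.instance Definition _ := isMeasure.Build _ _ _ lebesgue_step
  (measure0 nu) (measure_ge0 nu) (@measure_semi_sigma_additive _ _ _ nu).

Let lebesgue_step_sigma_finite : sigma_finite setT lebesgue_step.
Proof.
have /sigma_finiteP[F [TF ndF Foo]] := sigma_finiteT (@lebesgue_measure R).
have /sigma_finiteP[G [TG ndG Goo]] := sigma_finiteT mu.
exists (fun k => @rV_uncons n @^-1` (F k `*` G k)).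
  rewrite -preimage_bigcup -[LHS](preimage_setT (@rV_uncons n)); congr (_ @^-1` _).
  rewrite -setXTT TF TG predeqE => -[x y]; split.
    move=> [/= [k _ Fkx] [l _ Gly]]; exists (maxn k l) => //; split.
    - by move: x Fkx; exact/subsetPset/ndF/leq_maxl.
    - by move: y Gly; exact/subsetPset/ndG/leq_maxr.
  by move=> [k _ []/= ? ?]; split; exists k.
move=> k; have [mF Fkoo] := Foo k; have [mG Gkoo] := Goo k; split.
  rewrite -[X in measurable X]setTI.
  by apply: measurable_rV_uncons => //; exact: measurableX.
rewrite /lebesgue_step /pushforward -comp_preimage.
rewrite (_ : _ \o _ = id); last exact/funext/rV_consK.
by rewrite product_measure1E// lte_mul_pinfty// ge0_fin_numE.
Qed.

HB.instance Definition _ := Measure_isSigmaFinite.Build _ _ _ lebesgue_step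
  lebesgue_step_sigma_finite.

End lebesgue_step.

Fixpoint lebesgue_rV n : {sigma_finite_measure set 'rV[R]_n -> \bar R} :=
  match n with
  | 0 => \d_(0 : 'rV[R]_0)
  | n'.+1 => lebesgue_step (lebesgue_rV n')
  end.

Lemma lebesgue_rV_box n (A : 'I_n -> set R) :
  (forall i, measurable (A i)) ->
  lebesgue_rV n [set v | forall i, A i (v 0 i)] =
  (\prod_(i < n) lebesgue_measure (A i))%E.
Proof.
elim: n A => [|n IHn] A mA.
  by rewrite big_ord0 /= /dirac indicE mem_set// => -[].
rewrite big_ord_recl -(IHn (A \o lift ord0)); last by move=> i; exact: mA.
have mB : measurable [set v : 'rV[R]_n | forall i, (A \o lift ord0) i (v 0 i)].
  rewrite (_ : [set v | _] = \bigcap_(i in [set: 'I_n])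
      (fun v : 'rV[R]_n => v 0 i) @^-1` A (lift ord0 i)); last first.
    by apply/seteqP; split=> v Av i; [move=> _; exact: Av|exact: Av].
  apply: fin_bigcap_measurable => //.
  by move=> i _; rewrite -[X in measurable X]setTI; exact: measurable_coord.
rewrite /= /lebesgue_step /pushforward -[RHS]product_measure1E //; last exact: mA.
congr (_ _); apply/seteqP; split=> -[x v] /=.
  move=> Av; split; first by have := Av ord0; rewrite mxE unlift_none.
  by move=> i; have := Av (lift ord0 i); rewrite mxE liftK.
move=> [Ax Av] i; rewrite mxE.
by case: (unliftP ord0 i) => [j ->|->] //=; exact: Av.
Qed.

End lebesgue_rV.

Section domains.
Context (R : realType) (N : nat).
Implicit Types (Omega : set 'rV[R]_N) (x y : 'rV[R]_N).

Definition dot x y : R := \sum_i x 0 i * y 0 i.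

(* The library norm `|x| on 'rV[R]_N is the sup norm, hence the Euclidean one. *)
Definition enorm x : R := Num.sqrt (dot x x).

Definition domain Omega := [/\ open Omega, connected Omega & Omega !=set0].

(* Near each boundary point p, Omega is the region lying strictly above the
   graph, in the direction of a unit vector e, of a Lipschitz function on the
   hyperplane orthogonal to e; x - dot x e *: e is the orthogonal projection
   of x on that hyperplane. *)
Definition lipschitz_boundary Omega :=
  forall p, (closure Omega `\` interior Omega) p ->
  exists (e : 'rV[R]_N) (r L : R) (gamma : 'rV[R]_N -> R),
  [/\ enorm e = 1, 0 < r,
      forall x y, `|gamma x - gamma y| <= L * enorm (x - y) &
      forall x, enorm (x - p) < r ->
        (Omega x <-> gamma (x - dot x e *: e) < dot x e)].

Definition cone Omega :=
  [/\ domain Omega, lipschitz_boundary Omega &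
      forall (t : R) x, 0 < t -> Omega x -> Omega (t *: x)].

End domains.

Section sobolev.
Context (R : realType) (N : nat).
Implicit Types (Omega : set 'rV[R]_N).

Definition partial (i : 'I_N) (f : 'rV[R]_N -> R) : 'rV[R]_N -> R :=
  'D_(delta_mx 0 i) f.

Fixpoint Ck (k : nat) (f : 'rV[R]_N -> R) : Prop :=
  continuous f /\
  if k is k'.+1 then
    forall i, (forall x, derivable f x (delta_mx 0 i)) /\ Ck k' (partial i f)
  else True.

Definition test_function Omega (phi : 'rV[R]_N -> R) :=
  [/\ forall k, Ck k phi,
      compact (closure [set x | phi x != 0]) &
      closure [set x | phi x != 0] `<=` Omega].

Definition grad (f : 'rV[R]_N -> R) (x : 'rV[R]_N) : 'rV[R]_N :=
  \row_i partial i f x.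

Definition crit (s : R) : R := 2 * (N%:R - s) / (N%:R - 2).

(* A function together with its gradient; the type is an lmodType, with the
   pointwise operations. *)
Definition sob : Type := ('rV[R]_N -> R^o) * ('rV[R]_N -> 'rV[R]_N).
HB.instance Definition _ := GRing.Lmodule.on sob.

(* By the Sobolev inequality (N >= 3), a sequence of test functions that is
   Cauchy for the norm (\int |grad phi|^2)^{1/2} converges in L^{2N/(N-2)}, and
   its gradients converge in L^2; the completion is thus identified with the
   set of limits (u, grad u) of (phi_k, grad phi_k) in L^{2N/(N-2)} x L^2, the
   second component being determined a.e. by the first.  Note that
   2^*(0) = 2N/(N-2). *)
Definition D012 Omega : set sob :=
  [set u : sob | [/\ measurable_fun Omega (u.1 : _ -> R),
                     measurable_fun Omega u.2 &
    exists phi : ('rV[R]_N -> R)^nat,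
    [/\ forall k, test_function Omega (phi k),
        (\int[lebesgue_rV R N]_(x in Omega)
           (`|phi k x - u.1 x| `^ crit 0)%:E)%E @[k --> \oo] --> 0%E &
        (\int[lebesgue_rV R N]_(x in Omega)
           (enorm (grad (phi k) x - u.2 x) ^+ 2)%:E)%E @[k --> \oo] --> 0%E]]].

(* u = 0 in D_0^{1,2}(Omega); on D012 the gradient u.2 then vanishes a.e. too. *)
Definition null Omega (u : sob) :=
  {ae lebesgue_rV R N, forall x, Omega x -> u.1 x = 0}.

Definition dirichlet Omega (u : sob) : \bar R :=
  (\int[lebesgue_rV R N]_(x in Omega) (enorm (u.2 x) ^+ 2)%:E)%E.

Definition hardy_sobolev Omega (s : R) (u : sob) : \bar R :=
  (\int[lebesgue_rV R N]_(x in Omega)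
     (`|u.1 x| `^ crit s / enorm x `^ s)%:E)%E.

Definition mu_quotient Omega s (u : sob) : \bar R :=
  (dirichlet Omega u / hardy_sobolev Omega s u `^ (2 / crit s))%E.

Definition mu_s Omega s : \bar R :=
  ereal_inf [set mu_quotient Omega s u | u in D012 Omega `\` null Omega].

Definition extremal_mu_s Omega s (u : sob) :=
  [/\ D012 Omega u, ~ null Omega u & mu_quotient Omega s u = mu_s Omega s].

Section system.
Context (Omega : set 'rV[R]_N) (s alpha beta lambda mu kappa : R).
Implicit Types z : sob * sob.

Definition DD : set (sob * sob) := D012 Omega `*` D012 Omega.

Definition energy z : \bar R :=
  (\int[lebesgue_rV R N]_(x in Omega)
     (enorm (z.1.2 x) ^+ 2 + enorm (z.2.2 x) ^+ 2)%:E)%E.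

Definition coupling z : \bar R :=
  (\int[lebesgue_rV R N]_(x in Omega)
     (lambda * (`|z.1.1 x| `^ crit s / enorm x `^ s) +
      mu * (`|z.2.1 x| `^ crit s / enorm x `^ s) +
      crit s * kappa *
        (`|z.1.1 x| `^ alpha * `|z.2.1 x| `^ beta / enorm x `^ s))%:E)%E.

Definition DD_pos : set (sob * sob) :=
  [set z | DD z /\ (0 < coupling z)%E].

Definition S_quotient z : \bar R :=
  (energy z / coupling z `^ (2 / crit s))%E.

Definition S_inf : \bar R := ereal_inf [set S_quotient z | z in DD_pos].

Definition S_attained_at z := DD_pos z /\ S_quotient z = S_inf.

(* Phi is the energy functional of the system
     - Delta u - lambda |u|^{p-2} u / |x|^s = kappa alpha |u|^{alpha-2} u |v|^beta / |x|^s
     - Delta v - mu     |v|^{p-2} v / |x|^s = kappa beta |u|^alpha |v|^{beta-2} v / |x|^s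
   with p = crit s.  On DD both integrals are finite, by the Hardy-Sobolev
   inequality, so that fine loses nothing. *)
Definition Phi z : R :=
  2^-1 * fine (energy z) - (crit s)^-1 * fine (coupling z).

(* The constraint < Phi'(z), z > = 0: the derivative of Phi at z in the
   direction z exists and vanishes. *)
Definition nehari : set (sob * sob) :=
  [set z | [/\ DD z, ~ (null Omega z.1 /\ null Omega z.2) &
    is_derive (0 : R) (1 : R) (fun t : R => Phi (z + t *: z)) 0]].

Definition ground_state z :=
  nehari z /\ forall w, nehari w -> Phi z <= Phi w.

Definition semi_trivial z :=
  (~ null Omega z.1 /\ null Omega z.2) \/ (null Omega z.1 /\ ~ null Omega z.2).

End system.

End sobolev.

(* Main.v *)
Require Import Defs.
From HB Require Import structures.
From mathcomp Require Import all_boot all_order all_algebra.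
From mathcomp Require Import all_classical all_reals all_analysis.
From mathcomp Require Import measurable_realfun.
From mathcomp Require Import ring lra.
Import Order.TTheory GRing.Theory Num.Theory.
Import numFieldNormedType.Exports.
Set Implicit Arguments.
Unset Strict Implicit.
Unset Printing Implicit Defensive.
Local Open Scope classical_set_scope.
Local Open Scope ring_scope.


(** Write p = 2^*(s) > 2, r = 2/p < 1, M = max(lambda, mu), d(u) for the
    Dirichlet integral of u and h(u) for its Hardy-Sobolev integral.

    As kappa <= 0, the mixed term can only decrease the integral C(u, v) in the
    denominator, so C(u, v) <= lambda h(u) + mu h(v) <= M (h(u) + h(v)).  The
    numerator is d(u) + d(v) >= mu_s (h(u)^r + h(v)^r) >= mu_s (h(u) + h(v))^r,
    since t |-> t^r is subadditive.  The quotient is therefore at least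
    M^(-r) mu_s, and the pairs (u, 0) and (0, u) show that this bound is the
    infimum: lemmas coupled_le and S_infE.  At a minimizer all these inequalities
    are equalities.  If mu_s = 0, then d(u) = d(v) = 0 and u = v = 0, which the
    condition C(u, v) > 0 excludes; if mu_s > 0, the strict subadditivity of t^r
    forces h(u) = 0 or h(v) = 0, and the other component is extremal for mu_s and
    carries the weight M: lemmas coupled_eq and S_attained_cases.

    For this, d and h must be finite on D_0^{1,2}, and d(u) = 0 must imply u = 0.
    Both follow from the Hardy inequality int u^2/|x|^2 <= 16 int |grad u|^2.
    For a test function phi, the divergence of the field x phi^2/(|x|^2 + eps) has
    integral 0 by Fubini and the fundamental theorem of calculus
    (integral_partial_eq0); as N >= 3, it is bounded below by half of
    phi^2/(|x|^2 + eps) minus 2 |grad phi|^2 (hardy_regularized).  The inequality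
    passes to limits in D_0^{1,2} (hardy_trunc, hardy_D012).  Finally |u|^p/|x|^s
    is at most u^2/|x|^2 + |u|^q with q = 2^*(0) (hardy_sobolev_interp), and both
    terms are integrable.

    For ground states, with E the numerator,
    Phi((1+t) z) = (1+t)^2 E(z)/2 - (1+t)^p C(z)/p, so the constraint says that
    E(z) = C(z) (nehariE), and there Phi = (1/2 - 1/p) E.  Every w with C(w) > 0
    has a positive multiple that satisfies the constraint and whose energy, raised
    to the power 1 - r, is the quotient of w (nehari_projection).  A ground state
    thus minimizes the quotient (ground_state_attained), and the description of
    the minimizers applies to it. *)

(** * Measurability and integrability of functions on row vectors *)

Lemma rV_norm_coord (R : realType) n (x : 'rV[R]_n) i : `|x 0 i| <= `|x|.
Proof.
rewrite [leRHS]/Num.norm /= mx_normrE.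
by rewrite (le_bigmax _ (fun ij : 'I_1 * 'I_n => `|x ij.1 ij.2|) (ord0, i)).
Qed.

Lemma rV_norm_leP (R : realType) n (x : 'rV[R]_n) (M : R) : 0 <= M ->
  (`|x| <= M) <-> (forall i, `|x 0 i| <= M).
Proof.
move=> M0; split=> [xM i|xM]; first exact: le_trans (rV_norm_coord _ _) xM.
rewrite /Num.norm /= mx_normrE; apply: bigmax_le => // -[i j] _ /=.
by rewrite (ord1 i).
Qed.

Lemma measurable_coord_forall (R : realType) n (A : 'I_n -> set R) :
  (forall i, measurable (A i)) ->
  measurable [set v : 'rV[R]_n | forall i, A i (v 0 i)].
Proof.
move=> mA; rewrite (_ : [set v | _] = \bigcap_(i in [set: 'I_n])
    (fun v : 'rV[R]_n => v 0 i) @^-1` A i); last first.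
  by apply/seteqP; split=> v Av i; [move=> _; exact: Av|exact: Av].
apply: fin_bigcap_measurable => // i _.
by rewrite -[X in measurable X]setTI; exact: measurable_coord.
Qed.

(** An open set is the union of the countably many cubes with rational centre
    and radius 1/(k+1) that it contains, and cubes are boxes. *)
Lemma open_measurable_rV (R : realType) n (A : set 'rV[R]_n) :
  open A -> measurable A.
Proof.
move=> oA.
pose B (q : 'rV[rat]_n * nat) : set 'rV[R]_n :=
  [set v | forall i, `|v 0 i - ratr (q.1 0 i)| < (q.2.+1%:R)^-1].
pose F q := if `[< B q `<=` A >] then B q else set0.
rewrite (_ : A = \bigcup_q F q).
  apply: countable_bigcupT_measurable; first exact: countableP.
  move=> q; rewrite /F; case: ifP => // _.
  apply: (@measurable_coord_forall _ _ (fun i =>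
    [set t | `|t - ratr (q.1 0 i)| < (q.2.+1%:R)^-1])) => i.
  rewrite (_ : [set t | _] = ball (ratr (q.1 0 i) : R) (q.2.+1%:R)^-1).
    exact: measurable_ball.
  by apply/seteqP; split=> t; rewrite /ball/= distrC.
apply/seteqP; split=> [x Ax|x [q _]]; last first.
  by rewrite /F; case: ifPn => // /asboolP; exact.
move: oA; rewrite openE => /(_ _ Ax) /nbhs_ballP[e /= e0 xeA].
have [k ke] : exists k, (k.+1%:R)^-1 < e / 2 :> R.
  have /ltr_add_invr[k] : (0 : R) < e / 2 by rewrite divr_gt0.
  by rewrite add0r => ?; exists k.
have : 0 < (k.+1%:R : R)^-1 by rewrite invr_gt0.
set r := (_^-1) in ke *.
have [rE re] : r = (k.+1%:R)^-1 /\ r < e / 2 by [].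
clearbody r => r0.
have /all_sig[q qP] : forall i, {q : rat | `|x 0 i - ratr q| < r}.
  move=> i; apply: cid.
  have lt_r : x 0 i - r < x 0 i + r by lra.
  have [q] := rat_in_itvoo lt_r.
  rewrite in_itv/= => /andP[h1 h2]; exists q.
  by rewrite ltr_norml; lra.
exists (\row_i q i, k) => //; rewrite /F ifT; first by move=> i /=; rewrite mxE -rE.
apply/asboolP => y By; apply: xeA; split => // i j.
rewrite (ord1 i) /ball /=.
have := By j; have := qP j; rewrite /= mxE -rE !ltr_norml.
by move=> /andP[h1 h2] /andP[h3 h4]; lra.
Qed.

Lemma continuous_measurable_rV (R : realType) n (f : 'rV[R]_n -> R) :
  continuous f -> measurable_fun setT f.
Proof.
move=> cf; apply: (measurability _ (RGenOpens.measurableE R)).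
move=> _ [_ [a [b ->]] <-]; rewrite setTI.
apply: open_measurable_rV; apply: open_comp; first by move=> ? _; exact: cf.
exact: interval_open.
Qed.

Lemma closed_ball_rVE (R : realType) n (M : R) : 0 <= M ->
  [set v : 'rV[R]_n | `|v| <= M] =
  [set v | forall i, `[- M, M]%classic (v 0 i)].
Proof.
move=> M0; apply/seteqP; split=> v /=.
  by move/(rV_norm_leP _ M0) => h i; rewrite in_itv /= -ler_norml.
move=> h; apply/(rV_norm_leP _ M0) => i.
by have := h i; rewrite in_itv /= -ler_norml.
Qed.

Lemma closed_ball_rV_eq0 (R : realType) n (M : R) : M < 0 ->
  [set v : 'rV[R]_n | `|v| <= M] = set0.
Proof.
move=> M0; apply/seteqP; split=> // v /= /(le_trans (normr_ge0 _)).
by rewrite leNgt M0.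
Qed.

Lemma lebesgue_rV_ball (R : realType) n (M : R) :
  (lebesgue_rV R n [set v | (`|v| <= M)%R] < +oo)%E.
Proof.
have [M0|M0] := leP 0 M; last by rewrite closed_ball_rV_eq0// measure0.
rewrite closed_ball_rVE// (@lebesgue_rV_box R n (fun=> `[- M, M]%classic))//.
rewrite (eq_bigr (fun=> (M - - M)%:E)); last first.
  move=> i _; have := @lebesgue_measure_itv R `[- M, M]; rewrite /= lte_fin => ->.
  case: ltP => // h; apply/esym; congr EFin; lra.
by rewrite prodEFin ltry.
Qed.

Lemma measurable_ball_rV (R : realType) n (M : R) :
  measurable [set v : 'rV[R]_n | `|v| <= M].
Proof.
have [M0|M0] := leP 0 M; last by rewrite closed_ball_rV_eq0.
rewrite closed_ball_rVE//.
apply: (@measurable_coord_forall R n (fun=> `[- M, M]%classic)) => i.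
exact: measurable_itv.
Qed.

Lemma measurable_fun_rVP (R : realType) N d (T : measurableType d) (D : set T)
    (f : T -> 'rV[R]_N) : measurable D ->
  (forall i, measurable_fun D (fun x => f x 0 i)) -> measurable_fun D f.
Proof.
move=> mD mf; apply: (@measurability _ _ _ _ D f (@mx_cylinders R 1 N)) => //.
move=> _ [_ [i [j [B mB ->]]] <-]; rewrite (ord1 i).
by have := mf j mD B mB.
Qed.

Lemma measurable_fun_rV_coord (R : realType) N d (T : measurableType d) (D : set T)
    (f : T -> 'rV[R]_N) i : measurable_fun D f -> measurable_fun D (fun x => f x 0 i).
Proof. exact: (measurableT_comp (measurable_coord 0 i)). Qed.

Lemma measurable_funZ_rV (R : realType) N d (T : measurableType d) (D : set T)
    (f : T -> 'rV[R]_N) (c : R) :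
  measurable D -> measurable_fun D f -> measurable_fun D (fun x => c *: f x).
Proof.
move=> mD mf; apply: measurable_fun_rVP => // i; under eq_fun do rewrite mxE.
by apply: measurable_funM => //; exact: measurable_fun_rV_coord.
Qed.

Lemma measurable_funB_rV (R : realType) N d (T : measurableType d) (D : set T)
    (f g : T -> 'rV[R]_N) :
  measurable D -> measurable_fun D f -> measurable_fun D g ->
  measurable_fun D (fun x => f x - g x).
Proof.
move=> mD mf mg; apply: measurable_fun_rVP => // i; under eq_fun do rewrite !mxE.
by apply: measurable_funB; exact: measurable_fun_rV_coord.
Qed.

Lemma measurable_set1_rV (R : realType) n (a : 'rV[R]_n) : measurable [set a].
Proof.
rewrite (_ : [set a] = [set v : 'rV[R]_n | forall i, [set a 0 i] (v 0 i)]).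
  by apply: (@measurable_coord_forall _ _ (fun i => [set a 0 i])).
by apply/seteqP; split=> v /= => [-> //|h]; apply/rowP.
Qed.

Lemma lebesgue_rV_set1 (R : realType) n (a : 'rV[R]_n) : (0 < n)%N ->
  lebesgue_rV R n [set a] = 0%E.
Proof.
case: n a => // n a _.
rewrite (_ : [set a] = [set v : 'rV[R]_n.+1 | forall i, [set a 0 i] (v 0 i)]).
  rewrite (@lebesgue_rV_box R n.+1 (fun i => [set a 0 i]))//.
  by rewrite big_ord_recl lebesgue_measure_set1 mul0e.
by apply/seteqP; split=> v /= => [-> //|h]; apply/rowP.
Qed.

Definition bounded_support (R : realType) n (f : 'rV[R]_n -> R) :=
  exists M : R, forall x, M < `|x| -> f x = 0.

Lemma bounded_support_bounded (R : realType) n (f : 'rV[R]_n -> R) :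
  continuous f -> bounded_support f -> exists C, forall x, `|f x| <= C.
Proof.
move=> cf [M fM].
have cK : compact [set v : 'rV[R]_n | `|v| <= M].
  apply: bounded_closed_compact.
    exists M; split; first exact: num_real.
    by move=> r Mr x /= /le_trans; apply; exact: ltW.
  apply: (@closed_comp _ _ (fun v : 'rV[R]_n => `|v|) [set t | t <= M]).
    by move=> x _; apply: (@norm_continuous R ('rV[R]_n : normedModType R) x).
  exact: closed_le.
have : compact (f @` [set v : 'rV[R]_n | `|v| <= M]).
  by apply: continuous_compact => //; exact: continuous_subspaceT.
move/compact_bounded => [C [_ hC]].
exists (Num.max 0 (C + 1)) => x; have [xM|xM] := leP `|x| M.
  by rewrite le_max (hC (C + 1)) ?orbT ?ltrDl//; exists x.
by rewrite fM// normr0 le_max lexx.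
Qed.

Lemma bounded_support_integrable (R : realType) n (f : 'rV[R]_n -> R) :
  continuous f -> bounded_support f ->
  (lebesgue_rV R n).-integrable setT (EFin \o f).
Proof.
move=> cf bf; have [C fC] := bounded_support_bounded cf bf; have [M fM] := bf.
have mf := continuous_measurable_rV cf.
rewrite (_ : EFin \o f = (EFin \o f) \_ [set v : 'rV[R]_n | `|v| <= M]).
  apply: (iffLR (integrable_mkcond (EFin \o f) (@measurable_ball_rV R n M))).
  apply: (@measurable_bounded_integrable _ _ _ (lebesgue_rV R n)).
  - exact: measurable_ball_rV.
  - exact: lebesgue_rV_ball.
  - exact: measurable_funTS.
  - exists C; split; first exact: num_real.
    by move=> r Cr x _; exact: le_trans (fC x) (ltW Cr).
apply/funext => x /=; rewrite patchE; case: ifPn => //.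
by rewrite notin_setE/= => /negP; rewrite -ltNge => /fM ->.
Qed.

(** * Integrals of partial derivatives of functions with bounded support *)

Lemma rV_cons_norm1 (R : realType) n (t : R) (y : 'rV[R]_n) :
  `|t| <= `|rV_cons (t, y)|.
Proof.
have := rV_norm_coord (rV_cons (t, y)) ord0.
by rewrite mxE unlift_none.
Qed.

Lemma rV_cons_norm2 (R : realType) n (t : R) (y : 'rV[R]_n) :
  `|y| <= `|rV_cons (t, y)|.
Proof.
apply/rV_norm_leP => // i.
have := rV_norm_coord (rV_cons (t, y)) (lift ord0 i).
by rewrite mxE liftK.
Qed.

Lemma rV_cons_addl (R : realType) n (t h : R) (y : 'rV[R]_n) :
  h *: delta_mx 0 ord0 + rV_cons (t, y) = rV_cons (h *: 1 + t, y).
Proof.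
apply/rowP => j; rewrite !mxE eqxx /=.
case: (unliftP ord0 j) => [k ->|->] /=.
  by rewrite mulr0 add0r.
by [].
Qed.

Lemma rV_cons_addr (R : realType) n (t h : R) (y : 'rV[R]_n) i :
  h *: delta_mx 0 (lift ord0 i) + rV_cons (t, y) =
  rV_cons (t, h *: delta_mx 0 i + y).
Proof.
apply/rowP => j; rewrite !mxE eqxx /=.
case: (unliftP ord0 j) => [k ->|->] /=.
  by rewrite !mxE (inj_eq lift_inj).
by rewrite mulr0 add0r.
Qed.

Lemma rV_cons_continuousl (R : realType) n (y : 'rV[R]_n) :
  continuous (fun t : R => rV_cons (t, y)).
Proof.
move=> t A /nbhs_ballP[e /= e0 eA]; apply/nbhs_ballP; exists e => //= u tu.
apply: eA; split => // i j; rewrite !mxE.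
by case: (unliftP ord0 j) => [k _|_] //=; exact: ballxx.
Qed.

Lemma rV_cons_continuousr (R : realType) n (t : R) :
  continuous (fun y : 'rV[R]_n => rV_cons (t, y)).
Proof.
move=> y A /nbhs_ballP[e /= e0 eA]; apply/nbhs_ballP; exists e => //= u [_ yu].
apply: eA; split => // i j; rewrite !mxE.
by case: (unliftP ord0 j) => [k _|_] /=; [exact: yu|exact: ballxx].
Qed.

Lemma derive_outside_support (R : realType) (V : normedModType R) (f : V -> R)
    (M : R) (v x : V) :
  (forall x, M < `|x| -> f x = 0) -> M < `|x| -> 'D_v f x = 0.
Proof.
move=> fM Mx; rewrite (@near_eq_derive _ _ _ f (cst 0)) ?derive_cst//.
have : nbhs x (fun y => M < `|y|).
  apply: (@open_nbhs_nbhs _ x (Num.norm @^-1` [set t : R | M < t])); split => //.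
  by apply: open_comp (@open_gt _ M) => y _; exact: norm_continuous.
by apply: filterS => y /fM.
Qed.

Lemma integral_derive1_eq0 (R : realType) (g : R -> R) :
  (forall x, derivable g x 1) -> continuous ('D_1 g) ->
  (exists M : R, forall x, M < `|x| -> g x = 0) ->
  (\int[lebesgue_measure]_x ('D_1 g x)%:E = 0)%E.
Proof.
move=> dg cdg [M0 gM0].
have [M [M_gt0 gM]] : exists M : R, 0 < M /\ forall x, M < `|x| -> g x = 0.
  exists (Num.max 1 M0); split; first by rewrite lt_max ltr01.
  by move=> x; rewrite gt_max => /andP[_ /gM0].
have cg : continuous g.
  by move=> x; apply: differentiable_continuous; apply/derivable1_diffP.
have dgM x : M < `|x| -> 'D_1 g x = 0 by exact: derive_outside_support.
have gN : g (- (M + 1)) = 0 by apply: gM; rewrite normrN gtr0_norm; lra.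
have gP : g (M + 1) = 0 by apply: gM; rewrite gtr0_norm; lra.
transitivity (\int[lebesgue_measure]_(x in `[(- (M + 1))%R, (M + 1)%R]) ('D_1 g x)%:E)%E.
  rewrite [RHS]integral_mkcond; apply: eq_integral => x _; rewrite patchE.
  case: ifPn => //; rewrite notin_setE/= in_itv/= -ler_norml => /negP.
  rewrite -ltNge => xM; rewrite dgM//; lra.
rewrite (@continuous_FTC2 _ _ g) ?gN ?gP ?subee//.
- lra.
- exact: continuous_subspaceT.
- split.
  + by move=> x _; exact: dg.
  + by apply: cvg_at_right_filter; exact: cg.
  + by apply: cvg_at_left_filter; exact: cg.
- by move=> x _; rewrite derive1E.
Qed.

Lemma derive_rV_cons0 (R : realType) n (f : 'rV[R]_n.+1 -> R) t y :
  'D_(delta_mx 0 ord0) f (rV_cons (t, y)) = 'D_1 (fun u => f (rV_cons (u, y))) t.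
Proof.
rewrite /derive; set F := (X in lim (X @ _)); set G := (X in _ = lim (X @ _)).
suff -> : F = G by [].
by apply/funext => h; rewrite /F /G /= rV_cons_addl.
Qed.

Lemma derivable_rV_cons0 (R : realType) n (f : 'rV[R]_n.+1 -> R) t y :
  derivable f (rV_cons (t, y)) (delta_mx 0 ord0) ->
  derivable (fun u => f (rV_cons (u, y))) t 1.
Proof.
rewrite /derivable; set F := (X in cvg (X @ _)); set G := (X in _ -> cvg (X @ _)).
suff -> : F = G by [].
by apply/funext => h; rewrite /F /G /= rV_cons_addl.
Qed.

Lemma derive_rV_consS (R : realType) n (f : 'rV[R]_n.+1 -> R) t y i :
  'D_(delta_mx 0 (lift ord0 i)) f (rV_cons (t, y)) =
  'D_(delta_mx 0 i) (fun z => f (rV_cons (t, z))) y.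
Proof.
rewrite /derive; set F := (X in lim (X @ _)); set G := (X in _ = lim (X @ _)).
suff -> : F = G by [].
by apply/funext => h; rewrite /F /G /= rV_cons_addr.
Qed.

Lemma derivable_rV_consS (R : realType) n (f : 'rV[R]_n.+1 -> R) t y i :
  derivable f (rV_cons (t, y)) (delta_mx 0 (lift ord0 i)) ->
  derivable (fun z => f (rV_cons (t, z))) y (delta_mx 0 i).
Proof.
rewrite /derivable; set F := (X in cvg (X @ _)); set G := (X in _ -> cvg (X @ _)).
suff -> : F = G by [].
by apply/funext => h; rewrite /F /G /= rV_cons_addr.
Qed.

Lemma bounded_support_derive (R : realType) n (f : 'rV[R]_n -> R) v :
  bounded_support f -> bounded_support ('D_v f).
Proof. by move=> [M fM]; exists M => x; exact: derive_outside_support. Qed.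

(** The measure on row vectors of length n + 1 is an image of a product measure;
    this is what brings Fubini's theorem to bear on it. *)
Lemma integral_lebesgue_rVS (R : realType) n (f : 'rV[R]_n.+1 -> R) :
  continuous f -> bounded_support f ->
  (lebesgue_measure \x lebesgue_rV R n)%E.-integrable setT
     (fun p : measurableTypeR R * _ => (f (rV_cons p))%:E) /\
  (\int[lebesgue_rV R n.+1]_x (f x)%:E =
   \int[(lebesgue_measure \x lebesgue_rV R n)%E]_p
     (f (rV_cons (p : measurableTypeR R * _)))%:E)%E.
Proof.
move=> cf bf.
have mf := continuous_measurable_rV cf.
have mc := @measurable_rV_cons R n.
have intf : (lebesgue_measure \x lebesgue_rV R n)%E.-integrable setT
     (fun p : measurableTypeR R * _ => (f (rV_cons p))%:E).
  apply/integrableP; split.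
    by apply/measurable_EFinP; exact: (measurableT_comp mf mc).
  have /integrableP[_] := bounded_support_integrable cf bf.
  rewrite /= /lebesgue_step ge0_integral_pushforward//.
  by do 2 apply: measurableT_comp => //.
split=> //.
have mEf : measurable_fun [set: 'rV[R]_n.+1] (EFin \o f) by apply/measurable_EFinP.
exact: (@integral_pushforward _ _ (measurableTypeR R * 'rV[R]_n)%type
  'rV[R]_n.+1 R (@rV_cons R n) mc
  ((lebesgue_measure \x lebesgue_rV R n)%E :
    {measure set (measurableTypeR R * 'rV[R]_n) -> \bar R})
  setT (EFin \o f) mEf intf measurableT).
Qed.

(** By induction on the dimension: integrate first along the first coordinate if
    it is the one that is differentiated, where the fundamental theorem of
    calculus gives 0, and first along the other coordinates otherwise. *)
Lemma integral_partial_eq0 (R : realType) n (f : 'rV[R]_n -> R) i :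
  (forall x, derivable f x (delta_mx 0 i)) -> continuous f ->
  continuous ('D_(delta_mx 0 i) f) -> bounded_support f ->
  (\int[lebesgue_rV R n]_x ('D_(delta_mx 0 i) f x)%:E = 0)%E.
Proof.
elim: n f i => [f []//|n IHn f i df cf cdf bf].
have [intf ->] := integral_lebesgue_rVS cdf (bounded_support_derive _ bf).
have [M fM] := bf.
case: (unliftP ord0 i) => [j ij|i0]; subst i.
- rewrite -(integral12_prod_meas1 intf); apply: integral0_eq => t _.
  rewrite /fubini_F; under eq_integral do rewrite derive_rV_consS.
  have dE : 'D_(delta_mx 0 j) (fun z => f (rV_cons (t, z))) =
    (fun y => 'D_(delta_mx 0 (lift ord0 j)) f (rV_cons (t, y))).
    by apply/funext => y; rewrite derive_rV_consS.
  apply: IHn.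
  + by move=> y; exact/derivable_rV_consS/df.
  + by move=> y; apply: (@continuous_comp _ _ _ (fun z => rV_cons (t, z)) f);
      [exact: rV_cons_continuousr|exact: cf].
  + rewrite dE => y.
    by apply: (@continuous_comp _ _ _ (fun z => rV_cons (t, z))
      ('D_(delta_mx 0 (lift ord0 j)) f)); [exact: rV_cons_continuousr|exact: cdf].
  + by exists M => y My; apply: fM; exact: lt_le_trans My (rV_cons_norm2 _ _).
- rewrite -(integral21_prod_meas1 intf); apply: integral0_eq => y _.
  rewrite /fubini_G; under eq_integral do rewrite derive_rV_cons0.
  have dE : 'D_1 (fun u => f (rV_cons (u, y))) =
    (fun t => 'D_(delta_mx 0 ord0) f (rV_cons (t, y))).
    by apply/funext => t; rewrite derive_rV_cons0.
  apply: integral_derive1_eq0.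
  + by move=> t; exact/derivable_rV_cons0/df.
  + rewrite dE => t.
    by apply: (@continuous_comp _ _ _ (fun u => rV_cons (u, y))
      ('D_(delta_mx 0 ord0) f)); [exact: rV_cons_continuousl|exact: cdf].
  + by exists M => t Mt; apply: fM; exact: lt_le_trans Mt (rV_cons_norm1 _ _).
Qed.

(** * Hardy inequality for functions of class $C^1$ with bounded support *)

Section continuous_algebra.
Context (R : realType) (T : topologicalType).
Implicit Types f g : T -> R.

Lemma continuous_mul f g : continuous f -> continuous g ->
  continuous (fun x => f x * g x).
Proof. by move=> cf cg x; apply: continuousM; [exact: cf|exact: cg]. Qed.

Lemma continuous_add f g : continuous f -> continuous g ->
  continuous (fun x => f x + g x).
Proof. by move=> cf cg x; apply: (@continuousD _ _ _ f g x); [exact: cf|exact: cg]. Qed.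

Lemma continuous_sub f g : continuous f -> continuous g ->
  continuous (fun x => f x - g x).
Proof. by move=> cf cg x; apply: continuousB; [exact: cf|exact: cg]. Qed.

Lemma continuous_sqr f : continuous f -> continuous (fun x => f x ^+ 2).
Proof.
move=> cf; rewrite (_ : (fun _ => _) = (fun x => f x * f x)).
  exact: continuous_mul.
by apply/funext => x; rewrite expr2.
Qed.

Lemma continuous_inv f : continuous f -> (forall x, f x != 0) ->
  continuous (fun x => (f x)^-1).
Proof. by move=> cf f0 x; apply: continuousV; [exact: f0|exact: cf]. Qed.

Lemma continuous_cst (c : R) : continuous (fun _ : T => c).
Proof. exact: cst_continuous. Qed.

End continuous_algebra.

Lemma dotE (R : realType) n (x : 'rV[R]_n) : dot x x = \sum_i x 0 i ^+ 2.
Proof. by apply: eq_bigr => i _; rewrite expr2. Qed.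

Lemma dot_ge0 (R : realType) n (x : 'rV[R]_n) : 0 <= dot x x.
Proof. by rewrite dotE; apply: sumr_ge0 => i _; exact: sqr_ge0. Qed.

Lemma enorm_sqr (R : realType) n (x : 'rV[R]_n) : enorm x ^+ 2 = dot x x.
Proof. by rewrite sqr_sqrtr ?dot_ge0. Qed.

Lemma continuous_dot (R : realType) n :
  continuous (fun x : 'rV[R]_n => dot x x).
Proof.
apply: (@continuous_big _ _ _ 0 _ (@add_continuous R)) => i _ x.
by apply: continuousM; exact: coord_continuous.
Qed.

Lemma is_derive_coord (R : realType) n (x : 'rV[R]_n) (v : 'rV[R]_n) i :
  is_derive x v (fun y : 'rV[R]_n => y 0 i) (v 0 i).
Proof.
have H : (fun h : R => h^-1 *: (((fun y : 'rV[R]_n => y 0 i) \o shift x) (h *: v) - x 0 i))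
    @ 0^' --> v 0 i.
  apply: (@cvg_trans _ (cst (v 0 i) @ (0:R)^')); last exact: cvg_cst.
  apply: near_eq_cvg; near=> h => /=.
  rewrite !mxE addrK [_ *: _]mulrA mulVf ?mul1r//.
  by near: h; exact: nbhs_dnbhs_neq.
by split; [apply/cvg_ex; exists (v 0 i)|exact: cvg_lim H].
Unshelve. all: by end_near. Qed.

Lemma is_derive_dot (R : realType) n (x : 'rV[R]_n) i :
  is_derive x (delta_mx 0 i) (fun y => dot y y) (2 * x 0 i).
Proof.
have -> : (fun y : 'rV[R]_n => dot y y) =
    \sum_(j < n) (fun y : 'rV[R]_n => y 0 j) ^+ 2.
  apply/funext => y; rewrite dotE fct_sumE; apply: eq_bigr => j _.
  by rewrite exprfctE.
have -> : 2 * x 0 i = \sum_(j < n) (2%:R * x 0 j ^+ 1) *: ((delta_mx 0 i : 'rV[R]_n) 0 j).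
  rewrite (bigD1 i)//= big1 ?addr0 => [|j ji].
    by rewrite mxE !eqxx expr1 [_ *: _]mulr1.
  by rewrite mxE (negbTE ji) andbF scaler0.
apply: is_derive_sum => j; apply: is_derive_eq.
  apply: is_deriveX; exact: is_derive_coord.
by rewrite -mulr_natl.
Qed.

(** The field F = x phi^2 / (|x|^2 + eps), with components F i, is of class C^1
    because eps > 0; eps = 0 gives the field of the classical proof of Hardy's
    inequality, which is singular at the origin. *)
Section hardy.
Context (R : realType) (N : nat) (phi : 'rV[R]_N -> R) (eps : R).
Hypothesis (N3 : (3 <= N)%N) (eps0 : 0 < eps).
Hypothesis (cphi : continuous phi).
Hypothesis (dphi : forall i x, derivable phi x (delta_mx 0 i)).
Hypothesis (cdphi : forall i, continuous (partial i phi)).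
Hypothesis (bphi : bounded_support phi).

Let rho (x : 'rV[R]_N) := dot x x + eps.

Let rho_gt0 x : 0 < rho x.
Proof. by rewrite ltr_wpDl// dot_ge0. Qed.

Let F i (x : 'rV[R]_N) := x 0 i * (rho x)^-1 * phi x ^+ 2.
Let dF i (x : 'rV[R]_N) := phi x ^+ 2 / rho x
  - 2 * x 0 i ^+ 2 * phi x ^+ 2 / rho x ^+ 2
  + 2 * phi x * x 0 i * partial i phi x / rho x.

Let is_derive_F i x : is_derive x (delta_mx 0 i) (F i) (dF i x).
Proof.
have rho0 : rho x != 0 by rewrite gt_eqF.
have d1 := @is_derive_coord R N x (delta_mx 0 i) i.
have d2 : is_derive x (delta_mx 0 i) rho (2 * x 0 i + 0).
  by apply: (@is_deriveD _ _ _ (fun y => dot y y) (cst eps)); exact: is_derive_dot.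
have d3 : is_derive x (delta_mx 0 i) (fun y => (rho y)^-1) (- (rho x) ^- 2 *: (2 * x 0 i + 0)).
  case: d2 => d2 <-; split; first exact: derivableV.
  exact: deriveV.
have d4 := derivableP (@dphi i x).
have -> : F i = ((fun y : 'rV[R]_N => y 0 i) * (fun y => (rho y)^-1)) * phi ^+ 2.
  by apply/funext => y; rewrite /F /= -[RHS]/(_ * _ * (phi ^+ 2) y) exprfctE.
apply: is_derive_eq.
rewrite /= mxE !eqxx /dF /partial /=.
rewrite mulrfctE exprfctE /= -![_ *: _]/(_ * _).
by move: {d1 d2 d3 d4} (rho x) rho0 => r r0; field.
Qed.

Let ccoord i : continuous (fun x : 'rV[R]_N => x 0 i).
Proof. exact: coord_continuous. Qed.

Let crho : continuous rho.
Proof. by apply: continuous_add; [exact: continuous_dot|exact: continuous_cst]. Qed.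

Let cVrho : continuous (fun x => (rho x)^-1).
Proof. by apply: continuous_inv => // x; rewrite gt_eqF. Qed.

Let cF i : continuous (F i).
Proof.
apply: continuous_mul; last exact: continuous_sqr.
exact: continuous_mul.
Qed.

Let W x := phi x ^+ 2 / rho x.
Let T x := \sum_i (partial i phi x) ^+ 2.

Let cW : continuous W.
Proof. by apply: continuous_mul => //; exact: continuous_sqr. Qed.

Let cT : continuous T.
Proof.
apply: (@continuous_big _ _ _ 0 _ (@add_continuous R)) => i _.
exact: continuous_sqr.
Qed.

Let cdF i : continuous (dF i).
Proof.
have c2 : continuous (fun _ : 'rV[R]_N => 2 : R) by exact: continuous_cst.
have cp2 := continuous_sqr cphi.
apply: continuous_add; first apply: continuous_sub => //.
- apply: continuous_mul; last first.
    apply: continuous_inv; first exact: continuous_sqr.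
    by move=> x; rewrite sqrf_eq0 gt_eqF.
  apply: continuous_mul => //; apply: continuous_mul => //.
  exact: continuous_sqr.
- apply: continuous_mul => //; apply: continuous_mul => //.
  by apply: continuous_mul => //; apply: continuous_mul.
Qed.

Let bF i : bounded_support (F i).
Proof. by have [M pM] := bphi; exists M => x /pM; rewrite /F => ->; rewrite expr0n mulr0. Qed.

Let bW : bounded_support W.
Proof. by have [M pM] := bphi; exists M => x /pM; rewrite /W => ->; rewrite expr0n mul0r. Qed.

Let bT : bounded_support T.
Proof.
have [M pM] := bphi; exists M => x Mx; rewrite /T big1// => i _.
by rewrite /partial (derive_outside_support _ pM Mx) expr0n.
Qed.

Let derive_F i : 'D_(delta_mx 0 i) (F i) = dF i.
Proof. by apply/funext => x; have [] := is_derive_F i x. Qed.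

Let int_dF i : (\int[lebesgue_rV R N]_x (dF i x)%:E = 0)%E.
Proof.
rewrite -derive_F; apply: integral_partial_eq0 => //.
- by move=> x; have [] := is_derive_F i x.
- by rewrite derive_F.
Qed.

Let intdF i : (lebesgue_rV R N).-integrable setT (EFin \o dF i).
Proof.
by apply: bounded_support_integrable => //; rewrite -derive_F; exact: bounded_support_derive.
Qed.

(** With rho = |x|^2 + eps, the cross term of dF i is at least
    - phi^2 x_i^2 / (2 rho^2) - 2 (partial_i phi)^2.  As |x|^2 <= rho, the sum over
    i of the resulting bounds is at least (N - 5/2) W - 2 T, and N >= 3. *)
Let le_div x : 2^-1 * W x - 2 * T x <= \sum_i dF i x.
Proof.
have H i : W x - 5 / 2 * (W x * (x 0 i ^+ 2 / rho x)) - 2 * partial i phi x ^+ 2 <= dF i x.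
  rewrite /dF /W -subr_ge0.
  rewrite (_ : _ - _ = 2^-1 * (phi x * x 0 i / rho x + 2 * partial i phi x) ^+ 2).
    by rewrite mulr_ge0 ?sqr_ge0.
  by field; rewrite gt_eqF.
apply: le_trans (ler_sum _ (fun i _ => H i)).
rewrite !big_split/= sumr_const card_ord !sumrN -!mulr_sumr -mulr_suml -dotE lerD2r.
have W0 : 0 <= W x by rewrite divr_ge0 ?sqr_ge0 ?ltW.
have h1 : dot x x / rho x <= 1 by rewrite ler_pdivrMr// mul1r lerDl ltW.
have h2 : W x * (dot x x / rho x) <= W x by rewrite ler_piMr.
have h3 : W x * 3%:R <= W x * N%:R by rewrite ler_wpM2l ?ler_nat.
rewrite -[W x *+ N]mulr_natr; lra.
Qed.

Lemma hardy_regularized :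
  (\int[lebesgue_rV R N]_x (phi x ^+ 2 / (dot x x + eps))%:E <=
   4%:E * \int[lebesgue_rV R N]_x (enorm (grad phi x) ^+ 2)%:E)%E.
Proof.
have TE x : enorm (grad phi x) ^+ 2 = T x.
  by rewrite enorm_sqr dotE; apply: eq_bigr => i _; rewrite mxE.
under [in leRHS]eq_integral do rewrite TE.
have iW := bounded_support_integrable cW bW; have iT := bounded_support_integrable cT bT.
have : (\int[lebesgue_rV R N]_x (2^-1 * W x - 2 * T x)%:E <= 0)%E.
  have H0 : (\sum_(i < N) \int[lebesgue_rV R N]_x (dF i x)%:E = 0)%E.
    by apply: big1 => i _; exact: int_dF.
  rewrite -[leRHS]H0.
  rewrite -integral_sum//.
  apply: le_integral => //.
  - apply: bounded_support_integrable.
      by apply: continuous_sub; apply: continuous_mul => //; exact: continuous_cst.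
    have [M WM] := bW; have [M' TM'] := bT; exists (Num.max M M') => x.
    by rewrite gt_max => /andP[/WM -> /TM' ->]; rewrite !mulr0 subr0.
  - by apply: integrable_sum => // i _; exact: intdF.
  - by move=> x _; rewrite sumEFin lee_fin le_div.
have -> : (\int[lebesgue_rV R N]_x (2^-1 * W x - 2 * T x)%:E =
    2^-1%:E * \int[lebesgue_rV R N]_x (W x)%:E -
    2%:E * \int[lebesgue_rV R N]_x (T x)%:E)%E.
  rewrite -!integralZl// -integralB//; exact: integrableZl.
have fW := integrable_fin_num measurableT iW.
have fT := integrable_fin_num measurableT iT.
move: fW fT; rewrite -/W.
case: (integral _ _ (EFin \o W)) => // w _.
case: (integral _ _ (EFin \o T)) => // t _.
rewrite -!EFinM -EFinB !lee_fin; lra.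
Qed.
End hardy.

(** * Linear bounds on integrals, limits and the Euclidean norm *)

(** Packages monotonicity and linearity, so that the integral estimates below
    reduce to pointwise ones. *)
Lemma ge0_integral_le_lin (R : realType) d (T : measurableType d)
    (mu : {measure set T -> \bar R}) (D : set T) (f g h : T -> R) (a b : R) :
  measurable D -> 0 <= a -> 0 <= b ->
  (forall x, D x -> 0 <= f x) -> (forall x, D x -> 0 <= g x) ->
  (forall x, D x -> 0 <= h x) ->
  measurable_fun D f -> measurable_fun D g -> measurable_fun D h ->
  (forall x, D x -> f x <= a * g x + b * h x) ->
  (\int[mu]_(x in D) (f x)%:E <=
   a%:E * \int[mu]_(x in D) (g x)%:E + b%:E * \int[mu]_(x in D) (h x)%:E)%E.
Proof.
move=> mD a0 b0 f0 g0 h0 /measurable_EFinP mf /measurable_EFinP mg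
  /measurable_EFinP mh fgh.
rewrite -!ge0_integralZl_EFin//.
rewrite -ge0_integralD//; last 4 first.
- by move=> x Dx; rewrite mule_ge0// lee_fin// g0.
- exact: measurable_funeM.
- by move=> x Dx; rewrite mule_ge0// lee_fin// h0.
- exact: measurable_funeM.
apply: ge0_le_integral => //.
by apply: emeasurable_funD; exact: measurable_funeM.
Qed.

Lemma cvge0_lt (R : realType) (f : nat -> \bar R) (e : R) : 0 < e ->
  f k @[k --> \oo] --> 0%E -> \forall k \near \oo, (f k < e%:E)%E.
Proof.
move=> e0 f0; have /fine_cvgP[ffin /cvgrPdist_lt /(_ _ e0) fe] := f0.
near=> k; have : `|0 - fine (f k)| < e by near: k; exact: fe.
have fk : f k \is a fin_num by near: k.
by rewrite sub0r normrN -{2}(fineK fk) lte_fin => /(le_lt_trans (ler_norm _)).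
Unshelve. all: by end_near. Qed.

Lemma continuous_enorm (R : realType) n : continuous (@enorm R n).
Proof.
move=> x; apply: (@continuous_comp _ _ _ (fun x => dot x x) Num.sqrt).
  exact: continuous_dot.
exact: sqrt_continuous.
Qed.

Lemma enorm_eq0 (R : realType) n (x : 'rV[R]_n) : enorm x = 0 -> x = 0.
Proof.
move=> x0; have : dot x x = 0 by rewrite -enorm_sqr x0 expr0n.
rewrite dotE => /psumr_eq0P h; apply/rowP => i; rewrite mxE.
by apply/eqP; rewrite -sqrf_eq0 h// => j _; exact: sqr_ge0.
Qed.

Lemma measurable_enorm2 (R : realType) n d (T : measurableType d) (D : set T)
    (f : T -> 'rV[R]_n) :
  measurable_fun D f -> measurable_fun D (fun x => enorm (f x) ^+ 2).
Proof.
move=> mf; under eq_fun do rewrite enorm_sqr.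
apply: measurable_sum => i; apply: measurable_funM;
  by apply: (measurableT_comp (measurable_coord 0 i)).
Qed.

Lemma enorm_sqr_le2 (R : realType) n (x y : 'rV[R]_n) :
  enorm y ^+ 2 <= 2 * enorm (x - y) ^+ 2 + 2 * enorm x ^+ 2.
Proof.
rewrite !enorm_sqr !dotE !mulr_sumr -big_split /=; apply: ler_sum => i _.
rewrite !mxE -subr_ge0.
rewrite (_ : _ - _ = (2 * x 0 i - y 0 i) ^+ 2) ?sqr_ge0//; ring.
Qed.

(** * Test functions *)

Section test_functions.
Context (R : realType) (N : nat) (Omega : set 'rV[R]_N) (phi : 'rV[R]_N -> R).
Hypothesis tphi : test_function Omega phi.

Lemma test_continuous : continuous phi.
Proof. by case: tphi => /(_ 0%N)[]. Qed.

Lemma test_derivable i x : derivable phi x (delta_mx 0 i).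
Proof. by case: tphi => /(_ 1%N)[_ /(_ i)[]]. Qed.

Lemma test_partial_continuous i : continuous (partial i phi).
Proof. by case: tphi => /(_ 1%N)[_ /(_ i)[_ []]]. Qed.

Lemma test_bounded_support : bounded_support phi.
Proof.
case: tphi => _ /compact_bounded[M [_ HM]] _; exists (M + 1) => x Mx.
apply: contrapT => /eqP px; have := HM (M + 1); rewrite ltrDl => /(_ ltr01 x).
move=> /(_ (@subset_closure _ [set x | phi x != 0] x px)) /=; by rewrite leNgt Mx.
Qed.

Lemma test_grad_outside x : ~ Omega x -> grad phi x = 0.
Proof.
case: tphi => _ _ supO nOx; apply/rowP => i; rewrite !mxE.
rewrite /partial (@near_eq_derive _ _ _ phi (cst 0)) ?derive_cst//.
have : nbhs x (~` closure [set x | phi x != 0]).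
  apply: open_nbhs_nbhs; split; first exact/closed_openC/closed_closure.
  by move/supO.
apply: filterS => y; apply: contra_notP => /eqP py.
exact: (@subset_closure _ [set x | phi x != 0]).
Qed.

Lemma test_grad_measurable : measurable_fun setT (grad phi).
Proof.
apply: measurable_fun_mxP => i j; under eq_fun do rewrite mxE.
by apply: continuous_measurable_rV; exact: test_partial_continuous.
Qed.

(** Hardy's inequality is proved on the whole space, and D_0^{1,2} norms are
    taken over Omega; for test functions there is no difference. *)
Lemma test_integral_grad : open Omega ->
  (\int[lebesgue_rV R N]_x (enorm (grad phi x) ^+ 2)%:E =
   \int[lebesgue_rV R N]_(x in Omega) (enorm (grad phi x) ^+ 2)%:E)%E.
Proof.
move=> oO; rewrite [RHS]integral_mkcond; apply: eq_integral => x _.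
rewrite patchE; case: ifPn => //; rewrite notin_setE => /test_grad_outside ->.
by rewrite enorm_sqr dotE big1// => i _; rewrite mxE expr0n.
Qed.

Lemma test_integral_grad_fin :
  (\int[lebesgue_rV R N]_x (enorm (grad phi x) ^+ 2)%:E < +oo)%E.
Proof.
have cT : continuous (fun x => enorm (grad phi x) ^+ 2).
  rewrite (_ : (fun _ => _) = (fun x => \sum_i (partial i phi x) ^+ 2)).
    apply: (@continuous_big _ _ _ 0 _ (@add_continuous R)) => i _.
    by apply: continuous_sqr; exact: test_partial_continuous.
  by apply/funext => x; rewrite enorm_sqr dotE; apply: eq_bigr => i _; rewrite mxE.
apply: (integrable_lty measurableT); apply: bounded_support_integrable => //.
have [M pM] := test_bounded_support; exists M => x Mx; rewrite enorm_sqr dotE big1// => i _.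
by rewrite mxE /partial (derive_outside_support _ pM Mx) expr0n.
Qed.

End test_functions.

(** * Hardy inequality on $D_0^{1,2}$ *)

(** On sets of finite measure, convergence in L^q with q >= 2 implies convergence
    in L^2: integrate this bound for a = |u - phi|, with t small, then a^q small. *)
Lemma sqr_le_powR (R : realType) (a t q : R) : 0 <= a -> 0 < t -> 2 <= q ->
  a ^+ 2 <= t ^+ 2 + t `^ (2 - q) * a `^ q.
Proof.
move=> a0 t0 q2; have [at_|ta] := leP a t.
  apply: ler_wpDr; first by rewrite mulr_ge0 ?powR_ge0.
  by rewrite lerXn2r ?nnegrE// ltW.
apply: ler_wpDl; first exact: sqr_ge0.
have a_gt0 : 0 < a by exact: lt_trans ta.
have -> : a `^ q = a ^+ 2 * a `^ (q - 2).
  rewrite -powR_mulrn// -powRD; first by congr powR; ring.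
  by rewrite (gt_eqF a_gt0) implybT.
rewrite mulrCA ler_peMr ?sqr_ge0//.
have -> : 2 - q = - (q - 2) by ring.
rewrite powRN mulrC ler_pdivlMr ?powR_gt0// mul1r.
by apply: ge0_ler_powR; rewrite ?nnegrE ?subr_ge0// ltW.
Qed.

Lemma crit0_ge2 (R : realType) N : (3 <= N)%N -> 2 <= crit N (0 : R).
Proof.
move=> N3; have N3' : (3 : R) <= N%:R by rewrite ler_nat.
rewrite /crit subr0 ler_pdivlMr; lra.
Qed.

Section D012_hardy.
Context (R : realType) (N : nat) (Omega : set 'rV[R]_N) (u : sob R N).
Hypothesis (N3 : (3 <= N)%N) (oO : open Omega) (Du : D012 Omega u).

Local Notation q := (crit N (0 : R)).
Local Notation mu := (lebesgue_rV R N).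

Let mO : measurable Omega := open_measurable_rV oO.

Lemma D012_measurable : measurable_fun Omega (u.1 : _ -> R).
Proof. by case: Du. Qed.

Let mu1 := D012_measurable.

Lemma D012_measurable2 : measurable_fun Omega u.2.
Proof. by case: Du. Qed.

Let mu2 := D012_measurable2.

Lemma D012_approx (e : R) : 0 < e -> exists phi, [/\ test_function Omega phi,
   (\int[mu]_(x in Omega) (`|phi x - u.1 x| `^ q)%:E < e%:E)%E &
   (\int[mu]_(x in Omega) (enorm (grad phi x - u.2 x) ^+ 2)%:E < e%:E)%E].
Proof.
move=> e0; have [_ _ [phi [tphi /(cvge0_lt e0) h1 /(cvge0_lt e0) h2]]] := Du.
near \oo => k; exists (phi k); split; [exact: tphi| |].
- by near: k.
- by near: k.
Unshelve. all: by end_near. Qed.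

Let mdiff phi : test_function Omega phi ->
  measurable_fun Omega (fun x => `|phi x - u.1 x| `^ q).
Proof.
move=> tp; apply: (measurableT_comp (measurable_powR q)).
apply: (measurableT_comp (@normr_measurable _ _)); apply: measurable_funB => //.
apply: measurable_funTS; apply: continuous_measurable_rV.
exact: (test_continuous tp).
Qed.

Let mgrad phi : test_function Omega phi ->
  measurable_fun Omega (fun x => enorm (grad phi x) ^+ 2).
Proof.
move=> tp; apply: measurable_enorm2; apply: measurable_funTS.
exact: (test_grad_measurable tp).
Qed.

Let mgdiff phi : test_function Omega phi ->
  measurable_fun Omega (fun x => enorm (grad phi x - u.2 x) ^+ 2).
Proof.
move=> tp; apply: measurable_enorm2; apply: measurable_funB_rV => //.
by apply: measurable_funTS; exact: (test_grad_measurable tp).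
Qed.

Lemma dirichlet_lty : (dirichlet Omega u < +oo)%E.
Proof.
have [phi [tp _ h]] := D012_approx ltr01.
apply: (@le_lt_trans _ _
  (2%:E * \int[mu]_(x in Omega) (enorm (grad phi x - u.2 x) ^+ 2)%:E +
   2%:E * \int[mu]_(x in Omega) (enorm (grad phi x) ^+ 2)%:E)%E).
  apply: ge0_integral_le_lin; rewrite ?ler0n//; try by move=> x _; exact: sqr_ge0.
  - exact: measurable_enorm2.
  - exact: mgdiff.
  - exact: mgrad.
  - by move=> x _; exact: enorm_sqr_le2.
rewrite -(test_integral_grad tp oO); apply: lte_add_pinfty;
  apply: lte_mul_pinfty => //.
- exact: lt_trans h (ltry _).
- exact: (test_integral_grad_fin tp).
Qed.

(** On a bounded set, and with the bounded weight 1/(|x|^2 + eps), the approximation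
    of u by test functions phi in L^q controls the left-hand side.  Replacing u
    by phi, and then grad phi by grad u, costs a factor 2 each: 16 = 4 * 2 * 2. *)
Lemma hardy_trunc (M eps : R) : 0 < eps ->
  (\int[mu]_(x in Omega `&` [set x | (`|x| <= M)%R])
      ((u.1 x : R) ^+ 2 / (dot x x + eps))%:E <= 16%:E * dirichlet Omega u)%E.
Proof.
move=> eps0; set K := _ `&` _.
have mK : measurable K by apply: measurableI => //; exact: measurable_ball_rV.
have KO : K `<=` Omega by move=> x [].
have Kfin : (mu K < +oo)%E.
  apply: le_lt_trans (@lebesgue_rV_ball R N M); apply: le_measure; rewrite ?inE//.
    exact: measurable_ball_rV.
  by move=> x [].
have mKfin : mu K \is a fin_num by rewrite ge0_fin_numE// measure_ge0.
set m := fine (mu K); have m0 : 0 <= m by apply: fine_ge0; exact: measure_ge0.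
have mE : mu K = m%:E by rewrite fineK.
apply/lee_addgt0Pr => eta eta0.
(* With a = |u - phi|, the weight 2/eps and the bound a^2 <= t^2 + C a^q, this t
   makes the contribution of t^2 at most eta/4; e then does the same for a^q and
   for the error on the gradients. *)
pose t := Num.sqrt (eta * eps / (8 * (m + 1))).
have t2 : t ^+ 2 = eta * eps / (8 * (m + 1)).
  by rewrite sqr_sqrtr// divr_ge0// mulr_ge0// ?ltW//; lra.
have t0 : 0 < t by rewrite sqrtr_gt0 divr_gt0 ?mulr_gt0//; lra.
pose C := t `^ (2 - q); have C0 : 0 < C by exact: powR_gt0.
have [e [e0 e1 e2]] : exists e : R,
    [/\ 0 < e, 2 / eps * (C * e) <= eta / 4 & 16 * e <= eta / 4].
  exists (Num.min (eta * eps / (8 * C)) (eta / 64)); split.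
  - by rewrite lt_min !divr_gt0 ?mulr_gt0.
  - apply: (@le_trans _ _ (2 / eps * (C * (eta * eps / (8 * C))))).
      apply: ler_wpM2l; first by rewrite divr_ge0// ltW.
      by apply: ler_wpM2l; [exact: ltW|rewrite ge_min lexx].
    rewrite le_eqVlt; apply/orP; left; apply/eqP; field.
    by rewrite !gt_eqF.
  - have : Num.min (eta * eps / (8 * C)) (eta / 64) <= eta / 64.
      by rewrite ge_min lexx orbT.
    lra.
have [phi [tp h1 h2]] := D012_approx e0.
have crho : continuous (fun x : 'rV[R]_N => dot x x + eps).
  by apply: continuous_add; [exact: continuous_dot|exact: continuous_cst].
have rho0 (x : 'rV[R]_N) : 0 < dot x x + eps by rewrite ltr_wpDl// dot_ge0.
have mV : measurable_fun K (fun x : 'rV[R]_N => (dot x x + eps)^-1).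
  apply: measurable_funTS; apply: continuous_measurable_rV.
  by apply: continuous_inv => // x; rewrite gt_eqF.
have mphi : measurable_fun setT phi.
  by apply: continuous_measurable_rV; exact: (test_continuous tp).
have mPhi : measurable_fun setT (fun x => phi x ^+ 2 / (dot x x + eps)).
  apply: continuous_measurable_rV; apply: continuous_mul.
    by apply: continuous_sqr; exact: (test_continuous tp).
  by apply: continuous_inv => // x; rewrite gt_eqF.
have s1 : (\int[mu]_(x in K) ((u.1 x : R) ^+ 2 / (dot x x + eps))%:E <=
   2%:E * \int[mu]_(x in K) (phi x ^+ 2 / (dot x x + eps))%:E +
   (2 / eps)%:E * \int[mu]_(x in K) (t ^+ 2 + C * `|phi x - u.1 x| `^ q)%:E)%E.
  apply: ge0_integral_le_lin => //.
  - by rewrite divr_ge0// ltW.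
  - by move=> x _; rewrite divr_ge0 ?sqr_ge0// ltW.
  - by move=> x _; rewrite divr_ge0 ?sqr_ge0// ltW.
  - by move=> x _; rewrite addr_ge0 ?sqr_ge0// mulr_ge0 ?powR_ge0.
  - apply: measurable_funM => //; apply: measurable_funX.
    exact: measurable_funS mu1.
  - exact: measurable_funS mPhi.
  - apply: measurable_funD => //; apply: measurable_funM => //.
    exact: measurable_funS (mdiff tp).
  - move=> x _.
    have H := sqr_le_powR (normr_ge0 (phi x - u.1 x)) t0 (crit0_ge2 R N3).
    apply: (@le_trans _ _ (2 * (phi x ^+ 2 / (dot x x + eps)) +
       2 / (dot x x + eps) * `|phi x - u.1 x| ^+ 2)).
      rewrite real_normK ?num_real// -subr_ge0.
      rewrite (_ : _ - _ = (2 * phi x - u.1 x) ^+ 2 / (dot x x + eps)).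
        by rewrite divr_ge0 ?sqr_ge0// ltW.
      by field; rewrite gt_eqF.
    rewrite lerD2l; apply: ler_pM => //; first by rewrite divr_ge0// ltW.
    by apply: ler_wpM2l => //; rewrite lef_pV2 ?posrE// lerDr dot_ge0.
have s2 : (\int[mu]_(x in K) (phi x ^+ 2 / (dot x x + eps))%:E <=
  4%:E * (2%:E * e%:E + 2%:E * dirichlet Omega u))%E.
  apply: (@le_trans _ _ (\int[mu]_x (phi x ^+ 2 / (dot x x + eps))%:E)%E).
    apply: ge0_subset_integral => //; first exact/measurable_EFinP.
    by move=> x _; rewrite lee_fin divr_ge0 ?sqr_ge0// ltW.
  apply: le_trans (hardy_regularized N3 eps0 (test_continuous tp)
    (test_derivable tp) (test_partial_continuous tp) (test_bounded_support tp)) _.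
  rewrite lee_pmul2l// (test_integral_grad tp oO).
  apply: (@le_trans _ _ (2%:E * \int[mu]_(x in Omega) (enorm (grad phi x - u.2 x) ^+ 2)%:E
      + 2%:E * dirichlet Omega u)%E).
    apply: ge0_integral_le_lin; rewrite ?ler0n//; try by move=> x _; exact: sqr_ge0.
    - exact: mgrad.
    - exact: mgdiff.
    - exact: measurable_enorm2.
    - move=> x _; rewrite -[X in 2 * X + _](_ : enorm (u.2 x - grad phi x) ^+ 2 = _).
        exact: enorm_sqr_le2.
      by rewrite !enorm_sqr !dotE; apply: eq_bigr => i _; rewrite !mxE -sqrrN opprB.
  by apply: leeD => //; rewrite lee_pmul2l// ltW.
have s3 : (\int[mu]_(x in K) (t ^+ 2 + C * `|phi x - u.1 x| `^ q)%:E <=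
   (t ^+ 2 * m + C * e)%:E)%E.
  apply: (@le_trans _ _ ((t ^+ 2)%:E * \int[mu]_(x in K) (1%:E) +
     C%:E * \int[mu]_(x in K) (`|phi x - u.1 x| `^ q)%:E)%E).
    apply: ge0_integral_le_lin => //; rewrite ?sqr_ge0// ?ltW//.
    - by move=> x _; rewrite addr_ge0 ?sqr_ge0// mulr_ge0 ?powR_ge0.
    - apply: measurable_funD => //; apply: measurable_funM => //.
      exact: measurable_funS (mdiff tp).
    - exact: measurable_funS (mdiff tp).
    - by move=> x _; rewrite mulr1.
  have -> : (\int[mu]_(x in K) 1%:E = m%:E)%E.
    by rewrite -mE -[RHS]mul1e -integral_cst.
  rewrite -EFinM EFinD; apply: leeD => //.
  rewrite EFinM lee_pmul2l//; apply: le_trans (ltW h1).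
  apply: ge0_subset_integral => //; first by apply/measurable_EFinP; exact: (mdiff tp).
apply: le_trans s1 _.
apply: (@le_trans _ _ (2%:E * (4%:E * (2%:E * e%:E + 2%:E * dirichlet Omega u)) +
   (2 / eps)%:E * (t ^+ 2 * m + C * e)%:E)%E).
  by apply: leeD; rewrite lee_pmul2l// lte_fin divr_gt0.
have Dfin : dirichlet Omega u \is a fin_num.
  rewrite ge0_fin_numE ?dirichlet_lty//.
  by apply: integral_ge0 => x _; rewrite lee_fin sqr_ge0.
rewrite -(fineK Dfin) -!EFinM -!EFinD lee_fin.
have h3 : 2 / eps * (t ^+ 2 * m) <= eta / 4.
  rewrite t2 (_ : 2 / eps * _ = eta / 4 * (m / (m + 1))).
    by rewrite ler_piMr ?ler_pdivrMr//; lra.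
  by field; rewrite gt_eqF//=; lra.
lra.
Qed.

End D012_hardy.

Lemma powR_norm_quasi_triangle (R : realType) (q a b : R) : 0 <= q ->
  `|b| `^ q <= 2 `^ q * `|a - b| `^ q + 2 `^ q * `|a| `^ q.
Proof.
move=> q0; rewrite -!powRM//.
have H : `|b| <= `|a| + `|a - b| by have := ler_normB a (a - b); rewrite subKr.
have [c|c] := leP `|a - b| `|a|.
  apply: ler_wpDl; first exact: powR_ge0.
  by apply: ge0_ler_powR; rewrite ?nnegrE ?mulr_ge0//; lra.
apply: ler_wpDr; first exact: powR_ge0.
by apply: ge0_ler_powR; rewrite ?nnegrE ?mulr_ge0//; lra.
Qed.

Section D012_finiteness.
Context (R : realType) (N : nat) (Omega : set 'rV[R]_N) (u : sob R N).
Hypothesis (N3 : (3 <= N)%N) (oO : open Omega) (Du : D012 Omega u).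

Local Notation q := (crit N (0 : R)).
Local Notation mu := (lebesgue_rV R N).

Let mO : measurable Omega := open_measurable_rV oO.
Let mu1 := D012_measurable Du.

Lemma measurable_dotV : measurable_fun setT (fun x : 'rV[R]_N => (dot x x)^-1).
Proof.
rewrite (_ : (fun _ => _) = (@powR R ^~ (-1)) \o (fun x => dot x x)).
  apply: measurableT_comp; first exact: measurable_powR.
  by apply: continuous_measurable_rV; exact: continuous_dot.
by apply/funext => x /=; rewrite powR_inv1 ?dot_ge0.
Qed.

(** Monotone convergence along the balls of radius n with eps = 1/(n+1).  At the
    origin the integrand on the left is 0 by convention. *)
Lemma hardy_D012 :
  (\int[mu]_(x in Omega) ((u.1 x : R) ^+ 2 / dot x x)%:E <=
   16%:E * dirichlet Omega u)%E.
Proof.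
pose g n := (fun x : 'rV[R]_N => ((u.1 x : R) ^+ 2 / (dot x x + n.+1%:R^-1))%:E) \_
  [set x | `|x| <= n%:R].
have gn n : (\int[mu]_(x in Omega) g n x <= 16%:E * dirichlet Omega u)%E.
  by rewrite -integral_mkcondr; apply: hardy_trunc.
have rho0 n (x : 'rV[R]_N) : 0 < dot x x + n.+1%:R^-1.
  by rewrite ltr_wpDl ?dot_ge0 ?invr_gt0.
have g0 n x : (0 <= g n x)%E.
  rewrite /g patchE; case: ifP => // _.
  by rewrite lee_fin divr_ge0 ?sqr_ge0// ltW.
have mg n : measurable_fun Omega (g n).
  apply/measurable_restrict => //; first exact: measurable_ball_rV.
  apply/measurable_EFinP; apply: measurable_funM.
    apply: measurable_funX; apply: measurable_funS mu1 => //.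
  apply: measurable_funTS; apply: continuous_measurable_rV.
  apply: continuous_inv; last by move=> x; rewrite gt_eqF.
  by apply: continuous_add; [exact: continuous_dot|exact: continuous_cst].
have ndg x : {homo (g ^~ x) : n m / (n <= m)%N >-> (n <= m)%E}.
  move=> n m nm; rewrite {1}/g patchE; case: ifPn => [|_]; last exact: g0.
  rewrite inE/= => xn; rewrite /g patchE ifT; last first.
    by rewrite inE/= (le_trans xn)// ler_nat.
  rewrite lee_fin ler_wpM2l ?sqr_ge0// lef_pV2 ?posrE//.
  by rewrite lerD2l lef_pV2 ?posrE ?ler_nat.
have cvg_int := @cvg_monotone_convergence _ _ R mu _ mO _ mg
  (fun n x _ => g0 n x) (fun x _ => ndg x).
apply: (@le_trans _ _ (\int[mu]_(x in Omega) limn (g ^~ x))%E).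
  apply: ge0_le_integral => //.
  - by move=> x _; rewrite lee_fin divr_ge0 ?sqr_ge0 ?dot_ge0.
  - apply/measurable_EFinP; apply: measurable_funM; first exact: measurable_funX.
    by apply: measurable_funTS; exact: measurable_dotV.
  - apply: (emeasurable_fun_cvg g) => // x _; exact: ereal_nondecreasing_is_cvgn.
  - move=> x _; have [x0|x0] := eqVneq (dot x x) 0.
      rewrite x0 invr0 mulr0; apply: lime_ge; last by near=> n.
      exact: ereal_nondecreasing_is_cvgn.
    rewrite le_eqVlt; apply/orP; left; apply/eqP/esym/cvg_lim => //.
    apply: (@cvg_trans _
      ((fun n => ((u.1 x : R) ^+ 2 / (dot x x + n.+1%:R^-1))%:E) @ \oo)).
      apply: near_eq_cvg; near=> n; rewrite /g patchE ifT// inE /=.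
      by near: n; exact: nbhs_infty_ger.
    apply: cvg_EFin; first by near=> n.
    apply: cvgM; first exact: cvg_cst.
    apply: cvgV => //; rewrite -[X in _ --> X]addr0.
    by apply: cvgD; [exact: cvg_cst|exact: cvg_harmonic].
rewrite -(cvg_lim _ cvg_int)//.
apply: lime_le; first by apply/cvg_ex; eexists; exact: cvg_int.
by near=> n; exact: gn.
Unshelve. all: by end_near. Qed.

(** By definition of D_0^{1,2}, u is within finite L^q distance of a test function
    phi, which is in L^q since it is bounded and phi^2 is integrable. *)
Lemma D012_crit0_lty : (\int[mu]_(x in Omega) (`|u.1 x : R| `^ q)%:E < +oo)%E.
Proof.
have q2 := crit0_ge2 R N3; have q0 : 0 <= q by lra.
have [phi [tp h _]] := D012_approx Du ltr01.
have bp := bounded_support_bounded (test_continuous tp) (test_bounded_support tp).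
have mphi : measurable_fun setT phi.
  by apply: continuous_measurable_rV; exact: (test_continuous tp).
have mp : measurable_fun Omega (fun x => `|phi x| `^ q).
  apply: (measurableT_comp (measurable_powR q)).
  by apply: (measurableT_comp (@normr_measurable _ _)); apply: measurable_funTS.
have md : measurable_fun Omega (fun x => `|phi x - u.1 x| `^ q).
  apply: (measurableT_comp (measurable_powR q)).
  apply: (measurableT_comp (@normr_measurable _ _)); apply: measurable_funB => //.
  exact: measurable_funTS.
apply: (@le_lt_trans _ _ ((2 `^ q)%:E * \int[mu]_(x in Omega) (`|phi x - u.1 x| `^ q)%:E +
   (2 `^ q)%:E * \int[mu]_(x in Omega) (`|phi x| `^ q)%:E)%E).
  apply: ge0_integral_le_lin => //; rewrite ?powR_ge0//; try by move=> x _; exact: powR_ge0.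
  - apply: (measurableT_comp (measurable_powR q)).
    exact: (measurableT_comp (@normr_measurable _ _)).
  - by move=> x _; exact: powR_norm_quasi_triangle.
apply: lte_add_pinfty; apply: lte_mul_pinfty; rewrite ?lee_fin ?powR_ge0//.
  exact: lt_trans h (ltry _).
have [C pC] := bp.
apply: (@le_lt_trans _ _ ((C `^ (q - 2))%:E * \int[mu]_(x in Omega) (phi x ^+ 2)%:E +
   0%:E * \int[mu]_(x in Omega) (phi x ^+ 2)%:E)%E).
  apply: ge0_integral_le_lin => //; rewrite ?powR_ge0//; try by move=> x _; exact: sqr_ge0.
  - by apply: measurable_funX; exact: measurable_funTS.
  - by apply: measurable_funX; exact: measurable_funTS.
  - move=> x _; rewrite mul0r addr0.
    have [->|px] := eqVneq (phi x) 0.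
      by rewrite normr0 powR0 ?expr0n ?mulr0// gt_eqF//; lra.
    have -> : `|phi x| `^ q = `|phi x| `^ (q - 2) * phi x ^+ 2.
      rewrite -[phi x ^+ 2]real_normK ?num_real// -powR_mulrn// -powRD.
        by congr powR; ring.
      by rewrite normr_eq0 px implybT.
    rewrite ler_wpM2r ?sqr_ge0//; apply: ge0_ler_powR; rewrite ?nnegrE//; first by lra.
    exact: le_trans (pC x).
rewrite mul0e adde0; apply: lte_mul_pinfty; rewrite ?lee_fin ?powR_ge0//.
apply: (@le_lt_trans _ _ (\int[mu]_x (phi x ^+ 2)%:E)%E).
  apply: ge0_subset_integral => //.
    by apply/measurable_EFinP; exact: measurable_funX.
  by move=> x _; rewrite lee_fin sqr_ge0.
apply: (integrable_lty measurableT); apply: bounded_support_integrable.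
  by apply: continuous_sqr; exact: (test_continuous tp).
have [M pM] := test_bounded_support tp; exists M => x /pM ->; by rewrite expr0n.
Qed.

End D012_finiteness.

(** * The Hardy-Sobolev integral *)

(** A weighted geometric mean is at most the maximum. *)
Lemma powR_interp (R : realType) (X Y t : R) : 0 < X -> 0 < Y ->
  0 <= t -> t <= 1 -> X `^ t * Y `^ (1 - t) <= X + Y.
Proof.
move=> X0 Y0 t0 t1; have t1' : 0 <= 1 - t by rewrite subr_ge0.
have E (Z : R) : 0 < Z -> Z `^ t * Z `^ (1 - t) = Z.
  move=> Z0; rewrite -powRD; last by rewrite (gt_eqF Z0) implybT.
  by rewrite addrC subrK powRr1// ltW.
have [XY|/ltW YX] := leP X Y.
  apply: ler_wpDl; first exact: ltW.
  rewrite -[leRHS]E// ler_wpM2r ?powR_ge0//.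
  by apply: ge0_ler_powR; rewrite ?nnegrE// ltW.
apply: ler_wpDr; first exact: ltW.
rewrite -[leRHS]E// ler_wpM2l ?powR_ge0//.
by apply: ge0_ler_powR; rewrite ?nnegrE// ltW.
Qed.

Section crit_arith.
Context (R : realType) (N : nat) (s : R).
Hypothesis (N3 : (3 <= N)%N) (s0 : 0 < s) (s2 : s < 2).

Lemma crit_gt2 : 2 < crit N s.
Proof.
have N3' : (3 : R) <= N%:R by rewrite ler_nat.
rewrite /crit ltr_pdivlMr; last by lra.
by rewrite ltr_pM2l ?ltr0n// ltrD2l ltrN2.
Qed.

(** Writes |u|^p/|x|^s as (u^2/|x|^2)^(s/2) (|u|^q)^(1 - s/2) with q = 2^*(0). *)
Lemma crit_interp : crit N s = s + crit N 0 * (1 - s / 2).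
Proof.
have N3' : (3 : R) <= N%:R by rewrite ler_nat.
by rewrite /crit; field; rewrite gt_eqF//; lra.
Qed.

Lemma hardy_sobolev_interp (a : R) (x : 'rV[R]_N) :
  `|a| `^ crit N s / enorm x `^ s <= a ^+ 2 / dot x x + `|a| `^ crit N 0.
Proof.
have rhs0 : 0 <= a ^+ 2 / dot x x + `|a| `^ crit N 0.
  by rewrite addr_ge0 ?powR_ge0// divr_ge0 ?sqr_ge0// dot_ge0.
have p0 := crit_gt2.
have [r0|r0] := eqVneq (enorm x) 0.
  by rewrite r0 powR0 ?invr0 ?mulr0// gt_eqF.
have [a0|a0] := eqVneq a 0.
  by rewrite {1}a0 normr0 powR0 ?mul0r// gt_eqF//; lra.
have r_gt0 : 0 < enorm x by rewrite lt_neqAle eq_sym r0 sqrtr_ge0.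
have a_gt0 : 0 < `|a| by rewrite normr_gt0.
pose X := (`|a| / enorm x) ^+ 2; pose Y := `|a| `^ crit N 0.
have X0 : 0 < X by rewrite exprn_gt0// divr_gt0.
have Y0 : 0 < Y by exact: powR_gt0.
have -> : a ^+ 2 / dot x x = X by rewrite /X -enorm_sqr expr_div_n real_normK ?num_real.
have -> : `|a| `^ crit N s / enorm x `^ s = X `^ (s / 2) * Y `^ (1 - s / 2).
  have -> : X `^ (s / 2) = `|a| `^ s / enorm x `^ s.
    rewrite /X -powR_mulrn ?divr_ge0 ?ltW// -powRrM.
    have -> : 2%:R * (s / 2) = s by field.
    rewrite powRM ?invr_ge0 ?ltW//; congr (_ * _).
    by rewrite -powR_inv1 ?ltW// -powRrM mulN1r powRN.
  rewrite /Y -powRrM crit_interp powRD; last by rewrite (gt_eqF a_gt0) implybT.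
  by rewrite mulrAC.
by apply: powR_interp => //; move: s0 s2; lra.
Qed.

End crit_arith.

Lemma ae_neq0 (R : realType) N : (0 < N)%N ->
  {ae lebesgue_rV R N, forall x, x != 0}.
Proof.
move=> N0; exists [set 0]; split; first exact: measurable_set1_rV.
- exact: lebesgue_rV_set1.
- by move=> x /= /negP; rewrite negbK => /eqP.
Qed.

Section D012_null.
Context (R : realType) (N : nat) (Omega : set 'rV[R]_N) (s : R) (u : sob R N).
Hypothesis (N3 : (3 <= N)%N) (oO : open Omega) (Du : D012 Omega u).
Hypothesis (s0 : 0 < s) (s2 : s < 2).

Local Notation p := (crit N s).
Local Notation mu := (lebesgue_rV R N).

Let mO : measurable Omega := open_measurable_rV oO.
Let mu1 := D012_measurable Du.
Let p2 : 2 < p := crit_gt2 N3 s2.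

Lemma measurable_enormN (t : R) :
  measurable_fun Omega (fun x => (enorm x `^ t)^-1).
Proof.
rewrite (_ : (fun _ => _) = (@powR R ^~ (- t)) \o (@enorm R N)).
  apply: (measurableT_comp (measurable_powR _)).
  apply: measurable_funTS; apply: continuous_measurable_rV.
  exact: continuous_enorm.
by apply/funext => x /=; rewrite powRN.
Qed.

Lemma measurable_hs_integrand : measurable_fun Omega
  (fun x => `|u.1 x : R| `^ p / enorm x `^ s).
Proof.
apply: measurable_funM; last exact: measurable_enormN.
apply: (measurableT_comp (measurable_powR _)).
exact: (measurableT_comp (@normr_measurable _ _)).
Qed.

Lemma hs_integrand_ge0 x : 0 <= `|u.1 x : R| `^ p / enorm x `^ s.
Proof. by rewrite divr_ge0 ?powR_ge0. Qed.

Lemma hardy_sobolev_ge0 : (0 <= hardy_sobolev Omega s u)%E.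
Proof. by apply: integral_ge0 => x _; rewrite lee_fin hs_integrand_ge0. Qed.

Lemma dirichlet_ge0 : (0 <= dirichlet Omega u)%E.
Proof. by apply: integral_ge0 => x _; rewrite lee_fin sqr_ge0. Qed.

Lemma hardy_sobolev_lty : (hardy_sobolev Omega s u < +oo)%E.
Proof.
apply: (@le_lt_trans _ _ (1%:E * \int[mu]_(x in Omega) ((u.1 x : R) ^+ 2 / dot x x)%:E +
  1%:E * \int[mu]_(x in Omega) (`|u.1 x : R| `^ crit N 0)%:E)%E).
  apply: ge0_integral_le_lin => //.
  - by move=> x _; exact: hs_integrand_ge0.
  - by move=> x _; rewrite divr_ge0 ?sqr_ge0 ?dot_ge0.
  - exact: measurable_hs_integrand.
  - apply: measurable_funM; first exact: measurable_funX.
    by apply: measurable_funTS; exact: measurable_dotV.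
  - apply: (measurableT_comp (measurable_powR _)).
    exact: (measurableT_comp (@normr_measurable _ _)).
  - by move=> x _; rewrite !mul1r; exact: hardy_sobolev_interp.
rewrite !mul1e; apply: lte_add_pinfty; last exact: D012_crit0_lty.
apply: le_lt_trans (hardy_D012 N3 oO Du) _.
by apply: lte_mul_pinfty => //; exact: dirichlet_lty.
Qed.

Let ae_null (w : 'rV[R]_N -> R) :
  measurable_fun Omega w -> (forall x, 0 <= w x) ->
  (\int[mu]_(x in Omega) (w x)%:E = 0)%E ->
  (forall x, w x = 0 -> x != 0 -> u.1 x = 0) -> null Omega u.
Proof.
move=> mw w0 iw wu.
have : ae_eq mu Omega (fun x => (w x)%:E) (cst 0%E).
  apply/(ae_eq_integral_abs mu mO); first exact/measurable_EFinP.
  by rewrite -[RHS]iw; apply: eq_integral => x _; rewrite gee0_abs// lee_fin.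
have x0 := @ae_neq0 R N (ltn_trans (isT : (0 < 2)%N) N3).
move=> h; near=> x => Ox; apply: wu.
  have : Omega x -> (w x)%:E = 0%E by near: x.
  by move=> /(_ Ox) [].
by near: x.
Unshelve. all: by end_near. Qed.

(** The integrand vanishes at the origin whatever u is there, but the origin is
    a null set. *)
Lemma hardy_sobolev_eq0 : hardy_sobolev Omega s u = 0%E <-> null Omega u.
Proof.
split=> [h|nu].
  apply: (ae_null measurable_hs_integrand hs_integrand_ge0 h) => x /eqP.
  rewrite mulf_eq0 => /orP[|]; first by rewrite powR_eq0 normr_eq0 => /andP[/eqP].
  rewrite invr_eq0 powR_eq0 => /andP[/eqP/enorm_eq0 ->].
  by rewrite eqxx.
rewrite /hardy_sobolev (ae_eq_integral (cst 0%E))//; first exact: integral0.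
- by apply/measurable_EFinP; exact: measurable_hs_integrand.
- apply: filterS nu => x ux Ox; rewrite ux// normr0 powR0 ?mul0r// gt_eqF//.
  by apply: lt_trans p2; exact: ltr0n.
Qed.

(** By Hardy's inequality, u^2/|x|^2 has integral 0. *)
Lemma dirichlet_null : dirichlet Omega u = 0%E -> null Omega u.
Proof.
move=> d0; apply: (@ae_null (fun x => (u.1 x : R) ^+ 2 / dot x x)).
- apply: measurable_funM; first exact: measurable_funX.
  by apply: measurable_funTS; exact: measurable_dotV.
- by move=> x; rewrite divr_ge0 ?sqr_ge0 ?dot_ge0.
- apply/eqP; rewrite eq_le; apply/andP; split.
    by have := hardy_D012 N3 oO Du; rewrite d0 mule0.
  by apply: integral_ge0 => x _; rewrite lee_fin divr_ge0 ?sqr_ge0 ?dot_ge0.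
- move=> x /eqP; rewrite mulf_eq0 => /orP[|]; first by rewrite sqrf_eq0 => /eqP.
  rewrite invr_eq0 -enorm_sqr sqrf_eq0 => /eqP/enorm_eq0 ->.
  by rewrite eqxx.
Qed.

End D012_null.

(** * Concave powers and the equality case *)

(** x^r = x / x^(1 - r), and x^(1 - r) is increasing. *)
Lemma powR_subadd_strict (R : realType) (a b r : R) : 0 < a -> 0 < b -> r < 1 ->
  (a + b) `^ r < a `^ r + b `^ r.
Proof.
move=> a0 b0 r1; have ab0 : 0 < a + b by lra.
have E (x : R) : 0 < x -> x `^ r = x * (x `^ (1 - r))^-1.
  move=> x0; rewrite -powRN -{2}(powRr1 (ltW x0)) -powRD; last first.
    by rewrite (gt_eqF x0) implybT.
  by congr (_ `^ _); ring.
have lt_ (x : R) : 0 < x -> x < a + b ->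
    x * ((a + b) `^ (1 - r))^-1 < x * (x `^ (1 - r))^-1.
  move=> x0 xab; rewrite ltr_pM2l// ltf_pV2 ?posrE ?powR_gt0//.
  by apply: gt0_ltr_powR; rewrite ?nnegrE ?ltW// subr_gt0.
rewrite !E// mulrDl; apply: ltrD; apply: lt_ => //; lra.
Qed.

Lemma powR_subadd (R : realType) (a b r : R) : 0 <= a -> 0 <= b -> r < 1 ->
  (a + b) `^ r <= a `^ r + b `^ r.
Proof.
rewrite le_eqVlt => /predU1P[<- _ _|a0]; first by rewrite add0r lerDr powR_ge0.
rewrite le_eqVlt => /predU1P[<- _|b0]; first by rewrite addr0 lerDl powR_ge0.
by move=> r1; apply/ltW/powR_subadd_strict.
Qed.

(** In this section a, b stand for the Hardy-Sobolev integrals of the two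
    components, d1, d2 for their Dirichlet integrals, c for the denominator before
    exponentiation, m for mu_s and r for 2/p. *)
Section rigidity.
Context (R : realType) (lambda mu r a b c d1 d2 m : R).
Let M := Num.max lambda mu.

Lemma coupled_le : 0 < lambda -> 0 < mu -> 0 < r -> r < 1 ->
  0 <= a -> 0 <= b -> 0 <= m -> m * a `^ r <= d1 -> m * b `^ r <= d2 ->
  0 < c -> c <= lambda * a + mu * b ->
  m * c `^ r <= M `^ r * (d1 + d2).
Proof.
move=> l0 mu0 r0 r1 a0 b0 m0 h1 h2 c0 cab.
have M0 : 0 < M by rewrite lt_max l0.
have cM : c <= M * (a + b).
  apply: le_trans cab _; rewrite mulrDr.
  by apply: lerD; apply: ler_wpM2r => //; rewrite le_max lexx ?orbT.
apply: (@le_trans _ _ (m * (M `^ r * (a `^ r + b `^ r)))).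
  apply: ler_wpM2l => //; apply: (@le_trans _ _ ((M * (a + b)) `^ r)).
    by apply: ge0_ler_powR; rewrite ?nnegrE ?mulr_ge0 ?addr_ge0// ltW.
  rewrite powRM ?addr_ge0 ?(ltW M0)//; apply: ler_wpM2l; first exact: powR_ge0.
  exact: powR_subadd.
rewrite mulrCA; apply: ler_wpM2l; first exact: powR_ge0.
by rewrite mulrDr lerD.
Qed.

Lemma coupled_eq : 0 < lambda -> 0 < mu -> 0 < r -> r < 1 ->
  0 <= a -> 0 <= b -> 0 < m -> m * a `^ r <= d1 -> m * b `^ r <= d2 ->
  0 < c -> c <= lambda * a + mu * b ->
  M `^ r * (d1 + d2) <= m * c `^ r ->
  [/\ b = 0, 0 < a, lambda = M & d1 = m * a `^ r] \/
  [/\ a = 0, 0 < b, mu = M & d2 = m * b `^ r].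
Proof.
move=> l0 mu0 r0 r1 a0 b0 m0 h1 h2 c0 cab H.
have M0 : 0 < M by rewrite lt_max l0.
have Mr0 : 0 < M `^ r by exact: powR_gt0.
have lM : lambda <= M by rewrite le_max lexx.
have mM : mu <= M by rewrite le_max lexx orbT.
have cM : c <= M * (a + b).
  apply: le_trans cab _; rewrite mulrDr.
  by apply: lerD; apply: ler_wpM2r.
have ab0 : 0 < a + b by rewrite -(pmulr_rgt0 _ M0); exact: lt_le_trans cM.
have cMr : c `^ r <= M `^ r * (a + b) `^ r.
  rewrite -powRM ?(ltW M0) ?(ltW ab0)//.
  by apply: ge0_ler_powR; rewrite ?nnegrE ?mulr_ge0 ?(ltW M0) ?(ltW ab0)// ltW.
(* Equality in c <= M (a + b) will tell which weight is M, and key turns the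
   equality case for d1 + d2 into one for the subadditivity of t^r. *)
have key : d1 + d2 <= m * (a + b) `^ r.
  rewrite -(ler_pM2l Mr0) mulrCA; apply: le_trans H _.
  by rewrite ler_pM2l.
have cE : c = M * (a + b).
  apply/eqP; rewrite eq_le cM/= leNgt; apply/negP => lt_c.
  have : c `^ r < (M * (a + b)) `^ r.
    by apply: gt0_ltr_powR; rewrite ?nnegrE ?mulr_ge0 ?(ltW M0) ?(ltW ab0)// ltW.
  rewrite powRM ?(ltW M0) ?(ltW ab0)// -(ltr_pM2l m0) mulrCA => lt1.
  have : M `^ r * (d1 + d2) < M `^ r * (m * (a + b) `^ r) by exact: le_lt_trans H lt1.
  rewrite ltr_pM2l// ltNge => /negP; apply.
  apply: (@le_trans _ _ (m * a `^ r + m * b `^ r)); last exact: lerD.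
  by rewrite -mulrDr ler_pM2l//; exact: powR_subadd.
have [a_0|aN0] := eqVneq a 0.
  right; have bE : a + b = b by rewrite a_0 add0r.
  rewrite bE in ab0 cE key; split => //.
    move: cab; rewrite a_0 mulr0 add0r cE ler_pM2r// => ?.
    by apply/eqP; rewrite eq_le mM.
  apply/eqP; rewrite eq_le h2 andbT; apply: le_trans key.
  by rewrite lerDr; apply: le_trans h1; rewrite mulr_ge0 ?powR_ge0// ltW.
have a_gt0 : 0 < a by rewrite lt_neqAle eq_sym aN0.
have [b_0|bN0] := eqVneq b 0; last first.
  have b_gt0 : 0 < b by rewrite lt_neqAle eq_sym bN0.
  have := powR_subadd_strict a_gt0 b_gt0 r1.
  rewrite -(ltr_pM2l m0) mulrDr => h3.
  by have := lerD h1 h2; lra.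
left; have aE : a + b = a by rewrite b_0 addr0.
rewrite aE in cE key; split => //.
  move: cab; rewrite b_0 mulr0 addr0 cE ler_pM2r// => ?.
  by apply/eqP; rewrite eq_le lM.
apply/eqP; rewrite eq_le h1 andbT; apply: le_trans key.
by rewrite lerDl; apply: le_trans h2; rewrite mulr_ge0 ?powR_ge0// ltW.
Qed.

End rigidity.

(** * Finiteness of the energy and of the coupling integral *)

(** Both sides are compared with max(a, b)^p. *)
Lemma powR_mix_le (R : realType) (a b alpha beta p : R) :
  0 <= a -> 0 <= b -> 0 < alpha -> 0 < beta -> alpha + beta = p ->
  a `^ alpha * b `^ beta <= a `^ p + b `^ p.
Proof.
move=> a0 b0 al0 be0 <-.
have E (c : R) : 0 <= c -> c `^ alpha * c `^ beta = c `^ (alpha + beta).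
  rewrite le_eqVlt => /predU1P[<-|c0]; first by rewrite !powR0 ?mul0r// gt_eqF ?addr_gt0.
  by rewrite powRD// (gt_eqF c0) implybT.
have [ab|/ltW ba] := leP a b.
  apply: ler_wpDl; first exact: powR_ge0.
  rewrite -E// ler_wpM2r ?powR_ge0//.
  by apply: ge0_ler_powR; rewrite ?nnegrE// ltW.
apply: ler_wpDr; first exact: powR_ge0.
rewrite -E// ler_wpM2l ?powR_ge0//.
by apply: ge0_ler_powR; rewrite ?nnegrE// ltW.
Qed.

Lemma EFin_fine_lin3 (R : realType) (a b c : R) (x y z : \bar R) :
  x \is a fin_num -> y \is a fin_num -> z \is a fin_num ->
  (a * fine x + b * fine y + c * fine z)%:E = (a%:E * x + b%:E * y + c%:E * z)%E.
Proof. by case: x y z => [x| |] [y| |] [z| |]. Qed.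

Section pairs.
Context (R : realType) (N : nat) (Omega : set 'rV[R]_N).
Context (s alpha beta lambda mu kappa : R).
Hypothesis (N3 : (3 <= N)%N) (oO : open Omega).
Hypothesis (s0 : 0 < s) (s2 : s < 2).
Hypothesis (al1 : 1 < alpha) (be1 : 1 < beta) (albe : alpha + beta = crit N s).

Local Notation p := (crit N s).
Local Notation leb := (lebesgue_rV R N).
Local Notation D012 := (D012 Omega).
Local Notation coupling := (coupling Omega s alpha beta lambda mu kappa).

Let mO : measurable Omega := open_measurable_rV oO.
Let p2 : 2 < p := crit_gt2 N3 s2.
Let p0 : 0 < p. Proof. by apply: lt_trans p2; exact: ltr0n. Qed.
Let al0 : 0 < alpha. Proof. exact: lt_trans al1. Qed.
Let be0 : 0 < beta. Proof. exact: lt_trans be1. Qed.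

Let hs (u : sob R N) x : R := `|u.1 x : R| `^ p / enorm x `^ s.
Let mix (u v : sob R N) x : R :=
  `|u.1 x : R| `^ alpha * `|v.1 x : R| `^ beta / enorm x `^ s.

Let hsE u : hardy_sobolev Omega s u = (\int[leb]_(x in Omega) (hs u x)%:E)%E.
Proof. by []. Qed.

Lemma hardy_sobolev_fin u : D012 u -> hardy_sobolev Omega s u \is a fin_num.
Proof.
move=> Du; rewrite ge0_fin_numE; first exact: hardy_sobolev_lty.
exact: hardy_sobolev_ge0.
Qed.

Lemma dirichlet_fin u : D012 u -> dirichlet Omega u \is a fin_num.
Proof.
by move=> Du; rewrite ge0_fin_numE; [exact: dirichlet_lty|exact: dirichlet_ge0].
Qed.

Let int_hs u : D012 u -> leb.-integrable Omega (EFin \o hs u).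
Proof.
move=> Du; apply/integrableP; split.
  by apply/measurable_EFinP; exact: measurable_hs_integrand.
apply: le_lt_trans (hardy_sobolev_lty N3 oO Du s0 s2).
by rewrite hsE le_eqVlt; apply/orP; left; apply/eqP; apply: eq_integral => x _;
  rewrite gee0_abs// lee_fin hs_integrand_ge0.
Qed.

Let mix_ge0 u v x : 0 <= mix u v x.
Proof. by rewrite divr_ge0 ?mulr_ge0 ?powR_ge0. Qed.

Let measurable_mix u v : D012 u -> D012 v -> measurable_fun Omega (mix u v).
Proof.
move=> Du Dv; apply: measurable_funM; last exact: measurable_enormN.
apply: measurable_funM.
  apply: (measurableT_comp (measurable_powR _)).
  by apply: (measurableT_comp (@normr_measurable _ _)); exact: D012_measurable Du.
apply: (measurableT_comp (measurable_powR _)).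
by apply: (measurableT_comp (@normr_measurable _ _)); exact: D012_measurable Dv.
Qed.

Let int_mix u v : D012 u -> D012 v -> leb.-integrable Omega (EFin \o mix u v).
Proof.
move=> Du Dv; apply: (@le_integrable _ _ _ leb Omega mO _
  ((EFin \o hs u) \+ (EFin \o hs v))%E).
- by apply/measurable_EFinP; exact: measurable_mix.
- move=> x _; rewrite /= lee_fin ger0_norm//.
  rewrite ger0_norm ?addr_ge0 ?hs_integrand_ge0// /hs -mulrDl ler_wpM2r ?invr_ge0 ?powR_ge0//.
  exact: powR_mix_le.
- by apply: integrableD => //; exact: int_hs.
Qed.

Lemma coupling_integrable u v : D012 u -> D012 v ->
  leb.-integrable Omega (fun x => (lambda * (`|u.1 x : R| `^ p / enorm x `^ s) +
      mu * (`|v.1 x : R| `^ p / enorm x `^ s) +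
      p * kappa *
        (`|u.1 x : R| `^ alpha * `|v.1 x : R| `^ beta / enorm x `^ s))%:E).
Proof.
move=> Du Dv.
apply: (@eq_integrable _ _ _ leb Omega mO ((fun x => lambda%:E * (EFin \o hs u) x) \+
  (fun x => mu%:E * (EFin \o hs v) x) \+ (fun x => (p * kappa)%:E * (EFin \o mix u v) x))%E).
  by move=> x _; rewrite /= -!EFinM -!EFinD.
by do ![apply: integrableD => //|apply: integrableZl => //];
  [exact: int_hs|exact: int_hs|exact: int_mix].
Qed.

(** The three terms are integrable, so that the coupling integral is an honest sum.
    The number m is the integral of |u|^alpha |v|^beta / |x|^s. *)
Lemma couplingE u v : D012 u -> D012 v -> exists m : R,
  [/\ 0 <= m, null Omega u \/ null Omega v -> m = 0 &
   coupling (u, v) = (lambda * fine (hardy_sobolev Omega s u) +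
     mu * fine (hardy_sobolev Omega s v) + p * kappa * m)%:E].
Proof.
move=> Du Dv; pose m := (\int[leb]_(x in Omega) (mix u v x)%:E)%E.
have mfin : m \is a fin_num by exact: (integrable_fin_num mO (int_mix Du Dv)).
exists (fine m); split.
- by apply/fine_ge0/integral_ge0 => x _; rewrite lee_fin.
- move=> nuv; rewrite /m (ae_eq_integral (cst 0%E))//; first by rewrite integral0.
    by apply/measurable_EFinP; exact: measurable_mix.
  case: nuv => nu; apply: filterS nu => x ux Ox; rewrite /mix ux//.
    by rewrite normr0 powR0 ?gt_eqF// !mul0r.
  by rewrite normr0 powR0 ?gt_eqF// mulr0 mul0r.
rewrite (EFin_fine_lin3 _ _ _ (hardy_sobolev_fin Du) (hardy_sobolev_fin Dv) mfin).
rewrite !hsE -!integralZl//; [|exact: int_mix|exact: int_hs|exact: int_hs].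
rewrite -integralD//; [|by apply: integrableZl => //; exact: int_hs..].
rewrite -integralD//; last 2 first.
- by apply: integrableD => //; apply: integrableZl => //; exact: int_hs.
- by apply: integrableZl => //; exact: int_mix.
Qed.

Lemma energyE u v : D012 u -> D012 v ->
  energy Omega (u, v) = (fine (dirichlet Omega u) + fine (dirichlet Omega v))%:E.
Proof.
move=> Du Dv; rewrite EFinD !fineK ?dirichlet_fin// /dirichlet -ge0_integralD//.
- by move=> x _; rewrite lee_fin sqr_ge0.
- by apply/measurable_EFinP/measurable_enorm2; exact: D012_measurable2 Du.
- by move=> x _; rewrite lee_fin sqr_ge0.
- by apply/measurable_EFinP/measurable_enorm2; exact: D012_measurable2 Dv.
Qed.

End pairs.

(** * Scaling *)

Section scaling.
Context (R : realType) (N : nat) (Omega : set 'rV[R]_N).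
Local Notation leb := (lebesgue_rV R N).

Lemma partial_scale (c : R) (f : 'rV[R]_N -> R) i :
  (forall x, derivable f x (delta_mx 0 i)) ->
  partial i (fun x => c * f x) = (fun x => c * partial i f x).
Proof.
move=> df; apply/funext => x; rewrite /partial.
exact: (@deriveMl _ _ f c x (delta_mx 0 i) (df x)).
Qed.

Lemma Ck_scale k (c : R) (f : 'rV[R]_N -> R) :
  Ck k f -> Ck k (fun x => c * f x).
Proof.
elim: k f => [f [cf _]|k IH f [cf df]]; split => //.
- by apply: continuous_mul => //; exact: continuous_cst.
- by apply: continuous_mul => //; exact: continuous_cst.
- move=> i; have [dfi ckf] := df i; split.
    move=> x; have -> : (fun y => c * f y) = c *: (f : _ -> R^o) by [].
    exact: derivableZ.
  by rewrite partial_scale//; exact: IH.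
Qed.

Lemma test_function_scale (c : R) (phi : 'rV[R]_N -> R) :
  test_function Omega phi -> test_function Omega (fun x => c * phi x).
Proof.
move=> [ckp cp sp].
have sub : closure [set x | c * phi x != 0] `<=` closure [set x | phi x != 0].
  by apply: closure_subset => x /=; rewrite mulf_eq0 negb_or => /andP[].
split; [by move=> k; exact: Ck_scale| |exact: subset_trans sub sp].
exact: subclosed_compact (@closed_closure _ _) cp sub.
Qed.

Lemma enorm_scale (c : R) (x : 'rV[R]_N) : enorm (c *: x) ^+ 2 = c ^+ 2 * enorm x ^+ 2.
Proof.
by rewrite !enorm_sqr !dotE mulr_sumr; apply: eq_bigr => i _; rewrite mxE exprMn.
Qed.

Lemma D012_scale (c : R) (u : sob R N) : open Omega -> D012 Omega u -> D012 Omega (c *: u).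
Proof.
move=> oO [m1 m2 [phi [tp h1 h2]]]; have mO := open_measurable_rV oO; split.
- by apply: measurable_funM => //; exact: m1.
- exact: measurable_funZ_rV.
exists (fun k x => c * phi k x); split.
- by move=> k; exact: test_function_scale.
- have := cvgeZl (y := (`|c| `^ crit N 0)%:E) _ h1; rewrite mule0 => /(_ isT).
  apply: cvg_trans; apply: near_eq_cvg; near=> k.
  rewrite -ge0_integralZl_EFin ?powR_ge0//.
    by apply: eq_integral => x _; rewrite -EFinM -powRM// -normrM mulrBr.
  apply/measurable_EFinP; apply: (measurableT_comp (measurable_powR _)).
  apply: (measurableT_comp (@normr_measurable _ _)); apply: measurable_funB => //.
  apply: measurable_funTS; apply: continuous_measurable_rV.
  exact: (test_continuous (tp k)).
- have := cvgeZl (y := (c ^+ 2)%:E) _ h2; rewrite mule0 => /(_ isT).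
  apply: cvg_trans; apply: near_eq_cvg; near=> k.
  rewrite -ge0_integralZl_EFin ?sqr_ge0//.
    apply: eq_integral => x _; rewrite -EFinM -enorm_scale scalerBr.
    congr (enorm (_ - _) ^+ 2)%:E.
    apply/rowP => i; rewrite !mxE partial_scale// => y.
    exact: (test_derivable (tp k)).
    by move=> x _; rewrite lee_fin sqr_ge0.
  apply/measurable_EFinP; apply: measurable_enorm2.
  apply: measurable_funB_rV => //; apply: measurable_funTS.
  exact: (test_grad_measurable (tp k)).
Unshelve. all: by end_near. Qed.

End scaling.

(** * Minimization of the quotient *)

(** Serves as the zero component of semi-trivial pairs; taking 0 u reduces the
    membership in D_0^{1,2} to stability under scaling. *)
Lemma D012_null_element (R : realType) N (Omega : set 'rV[R]_N) (u : sob R N) :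
  open Omega -> D012 Omega u ->
  exists w : sob R N, [/\ D012 Omega w, null Omega w & dirichlet Omega w = 0%E].
Proof.
move=> oO Du; exists (0 *: u); split; first exact: D012_scale.
  by apply: nearW => x _; exact: mul0r.
rewrite /dirichlet (eq_integral (cst 0%E)) ?integral0// => x _.
have -> : enorm ((0 *: u).2 x) ^+ 2 = 0 ^+ 2 * enorm (u.2 x) ^+ 2 by exact: enorm_scale.
by rewrite expr0n mul0r.
Qed.

Lemma lin_comb2_eq0 (R : realType) (l k a b : R) :
  a = 0 -> b = 0 -> l * a + k * b = 0.
Proof. by move=> -> ->; rewrite !mulr0 addr0. Qed.

Lemma lin_comb3_fst (R : realType) (l k c a b m : R) :
  b = 0 -> m = 0 -> l * a + k * b + c * m = l * a.
Proof. by move=> -> ->; rewrite !mulr0 !addr0. Qed.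

Lemma lin_comb3_snd (R : realType) (l k c a b m : R) :
  b = 0 -> m = 0 -> l * b + k * a + c * m = k * a.
Proof. by move=> -> ->; rewrite !mulr0 add0r addr0. Qed.

Section minimization.
Context (R : realType) (N : nat) (Omega : set 'rV[R]_N).
Context (s alpha beta lambda mu kappa : R).
Hypothesis (N3 : (3 <= N)%N) (oO : open Omega).
Hypothesis (s0 : 0 < s) (s2 : s < 2).
Hypothesis (al1 : 1 < alpha) (be1 : 1 < beta) (albe : alpha + beta = crit N s).
Hypothesis (la0 : 0 < lambda) (mu0 : 0 < mu) (ka0 : kappa <= 0).

Local Notation p := (crit N s).
Local Notation r := (2 / crit N s).
Local Notation D012 := (D012 Omega).
Local Notation coupling := (coupling Omega s alpha beta lambda mu kappa).
Local Notation M := (Num.max lambda mu).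
Local Notation d u := (fine (dirichlet Omega u)).
Local Notation h u := (fine (hardy_sobolev Omega s u)).
Local Notation DD_pos := (DD_pos Omega s alpha beta lambda mu kappa).
Local Notation S_quotient := (S_quotient Omega s alpha beta lambda mu kappa).
Local Notation S_inf := (S_inf Omega s alpha beta lambda mu kappa).

Let p2 : 2 < p := crit_gt2 N3 s2.
Let p0 : 0 < p. Proof. by apply: lt_trans p2; exact: ltr0n. Qed.
Let r0 : 0 < r. Proof. by rewrite divr_gt0. Qed.
Let r1 : r < 1. Proof. by rewrite ltr_pdivrMr// mul1r. Qed.
Let M0 : 0 < M. Proof. by rewrite lt_max la0. Qed.

Let d_ge0 u : 0 <= d u. Proof. by apply/fine_ge0/dirichlet_ge0. Qed.
Let h_ge0 u : 0 <= h u. Proof. by apply/fine_ge0/hardy_sobolev_ge0. Qed.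

Lemma fine_hs_eq0 u : D012 u -> h u = 0 <-> null Omega u.
Proof.
move=> Du; rewrite -(hardy_sobolev_eq0 N3 oO Du s2).
split=> [h0|->//]; rewrite -(fineK (hardy_sobolev_fin N3 oO s0 s2 Du)).
by rewrite h0.
Qed.

Lemma fine_hs_gt0 u : D012 u -> ~ null Omega u -> 0 < h u.
Proof.
move=> Du nu; rewrite lt_neqAle h_ge0 andbT; apply/eqP => /esym.
by move/(fine_hs_eq0 Du).
Qed.

Lemma fine_dirichlet_eq0 u : D012 u -> d u = 0 -> null Omega u.
Proof.
move=> Du d0; apply: (dirichlet_null N3 oO Du).
by rewrite -(fineK (dirichlet_fin oO Du)) d0.
Qed.

Lemma mu_quotientE u : D012 u -> ~ null Omega u ->
  mu_quotient Omega s u = (d u / h u `^ r)%:E.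
Proof.
move=> Du nu; rewrite /mu_quotient.
rewrite -(fineK (hardy_sobolev_fin N3 oO s0 s2 Du)) -(fineK (dirichlet_fin oO Du)) /=.
by rewrite inver gt_eqF// powR_gt0// fine_hs_gt0.
Qed.

Lemma S_quotientE u v c : D012 u -> D012 v -> coupling (u, v) = c%:E -> 0 < c ->
  S_quotient (u, v) = ((d u + d v) / c `^ r)%:E.
Proof.
move=> Du Dv cE c0; rewrite /S_quotient (energyE oO Du Dv) cE poweR_EFin.
by rewrite inver gt_eqF// powR_gt0.
Qed.

Lemma coupling_le u v : D012 u -> D012 v -> exists c : R,
  coupling (u, v) = c%:E /\ c <= lambda * h u + mu * h v.
Proof.
move=> Du Dv.
have [m [m0 _ cE]] := couplingE lambda mu kappa N3 oO s0 s2 al1 be1 albe Du Dv.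
eexists; split; first exact: cE.
by rewrite gerDl mulr_le0_ge0// mulr_ge0_le0// ltW.
Qed.

(** mu_s is infinite when D_0^{1,2} is reduced to null functions; as soon as it is
    not, mu_s is the best real constant in the Hardy-Sobolev inequality, which holds
    for null functions too since 0^r = 0. *)
Lemma mu_s_fin u : D012 u -> ~ null Omega u -> exists m : R,
  [/\ mu_s Omega s = m%:E, 0 <= m &
      forall w, D012 w -> m * h w `^ r <= d w].
Proof.
move=> Du nu.
have mu_ge0 : (0 <= mu_s Omega s)%E.
  apply/ereal_infP => _ [w [Dw nw] <-]; rewrite mu_quotientE// lee_fin.
  by rewrite divr_ge0 ?powR_ge0.
have mu_le w : D012 w -> ~ null Omega w -> (mu_s Omega s <= (d w / h w `^ r)%:E)%E.
  by move=> Dw nw; rewrite -mu_quotientE//; apply: ereal_inf_lbound; exists w.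
have mfin : mu_s Omega s \is a fin_num.
  by rewrite ge0_fin_numE//; apply: le_lt_trans (mu_le _ Du nu) (ltry _).
exists (fine (mu_s Omega s)); split; rewrite ?fineK ?fine_ge0// => w Dw.
have [nw|nw] := pselect (null Omega w).
  by rewrite (fine_hs_eq0 Dw).2// powR0 ?mulr0// gt_eqF.
have := mu_le _ Dw nw; rewrite -{1}(fineK mfin) lee_fin.
by rewrite ler_pdivlMr// powR_gt0// fine_hs_gt0.
Qed.

Lemma DD_pos_nonnull u v : DD_pos (u, v) -> ~ null Omega u \/ ~ null Omega v.
Proof.
move=> [[Du Dv] c_gt0]; apply/not_andP => -[nu nv].
have [c [cE cle]] := coupling_le Du Dv.
move: c_gt0; rewrite cE lte_fin ltNge => /negP; apply.
apply: le_trans cle _.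
by rewrite (lin_comb2_eq0 _ _ ((fine_hs_eq0 Du).2 nu) ((fine_hs_eq0 Dv).2 nv)).
Qed.

Lemma DD_pos_mu_s_fin u v : DD_pos (u, v) -> exists m : R,
  [/\ mu_s Omega s = m%:E, 0 <= m & forall w, D012 w -> m * h w `^ r <= d w].
Proof.
move=> Duv; have [[Du Dv] _] := Duv.
by have [nu|nv] := DD_pos_nonnull Duv; [exact: (mu_s_fin Du nu)|exact: (mu_s_fin Dv nv)].
Qed.

Lemma S_quotient_fst u w : D012 u -> ~ null Omega u ->
  D012 w -> null Omega w -> dirichlet Omega w = 0%E ->
  DD_pos (u, w) /\
  S_quotient (u, w) = ((lambda `^ (- r))%:E * mu_quotient Omega s u)%E.
Proof.
move=> Du nu Dw nw dw.
have [m [_ m0 cE]] := couplingE lambda mu kappa N3 oO s0 s2 al1 be1 albe Du Dw.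
have hu := fine_hs_gt0 Du nu.
have {}cE : coupling (u, w) = (lambda * h u)%:E.
  by rewrite cE (lin_comb3_fst _ _ _ _ ((fine_hs_eq0 Dw).2 nw) (m0 (or_intror nw))).
have lh : 0 < lambda * h u by rewrite mulr_gt0.
split; first (split; first exact: (conj Du Dw)); first by rewrite cE lte_fin.
rewrite (S_quotientE Du Dw cE lh) (mu_quotientE Du nu) -EFinM dw; congr EFin.
by rewrite addr0 powRM ?(ltW la0) ?(ltW hu)// invfM powRN mulrCA mulrA.
Qed.

Lemma S_quotient_snd u w : D012 u -> ~ null Omega u ->
  D012 w -> null Omega w -> dirichlet Omega w = 0%E ->
  DD_pos (w, u) /\
  S_quotient (w, u) = ((mu `^ (- r))%:E * mu_quotient Omega s u)%E.
Proof.
move=> Du nu Dw nw dw.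
have [m [_ m0 cE]] := couplingE lambda mu kappa N3 oO s0 s2 al1 be1 albe Dw Du.
have hu := fine_hs_gt0 Du nu.
have {}cE : coupling (w, u) = (mu * h u)%:E.
  by rewrite cE (lin_comb3_snd _ _ _ _ ((fine_hs_eq0 Dw).2 nw) (m0 (or_introl nw))).
have lh : 0 < mu * h u by rewrite mulr_gt0.
split; first (split; first exact: (conj Dw Du)); first by rewrite cE lte_fin.
rewrite (S_quotientE Dw Du cE lh) (mu_quotientE Du nu) -EFinM dw; congr EFin.
by rewrite add0r powRM ?(ltW mu0) ?(ltW hu)// invfM powRN mulrCA mulrA.
Qed.

Lemma S_infE : S_inf = ((M `^ (- r))%:E * mu_s Omega s)%E.
Proof.
have Mr : 0 < M `^ r by exact: powR_gt0.
apply/eqP; rewrite eq_le; apply/andP; split.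
  rewrite powRN lee_pdivlMl//; apply/ereal_infP => _ [u [Du nu] <-].
  rewrite -lee_pdivlMl// -powRN.
  have [w [Dw nw dw]] := D012_null_element oO Du.
  have [lm|ml] := leP lambda mu.
    have [zpos <-] := S_quotient_snd Du nu Dw nw dw.
    by apply: ereal_inf_lbound; exists (w, u).
  have [zpos <-] := S_quotient_fst Du nu Dw nw dw.
  by apply: ereal_inf_lbound; exists (u, w).
apply/ereal_infP => _ [[u v] Duv <-]; have [[Du Dv] c_gt0] := Duv.
have [m [-> m0 hm]] := DD_pos_mu_s_fin Duv.
have [c [cE cle]] := coupling_le Du Dv; rewrite cE lte_fin in c_gt0.
rewrite (S_quotientE Du Dv cE c_gt0) -EFinM lee_fin.
rewrite powRN mulrC ler_pdivlMr ?powR_gt0// mulrAC ler_pdivrMr// [leRHS]mulrC.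
exact: (coupled_le la0 mu0 r0 r1 (h_ge0 u) (h_ge0 v) m0 (hm _ Du) (hm _ Dv) c_gt0 cle).
Qed.

(** The case mu_s = 0 has to be excluded first: a minimizer would have zero
    energy, hence be null. *)
Lemma S_attained_cases u v :
  S_attained_at Omega s alpha beta lambda mu kappa (u, v) ->
  [/\ lambda = M, extremal_mu_s Omega s u & null Omega v] \/
  [/\ mu = M, null Omega u & extremal_mu_s Omega s v].
Proof.
move=> [Duv]; have [[Du Dv] c_gt0] := Duv; rewrite S_infE.
have [m [mE m0 hm]] := DD_pos_mu_s_fin Duv.
have [c [cE cle]] := coupling_le Du Dv; rewrite cE lte_fin in c_gt0.
rewrite (S_quotientE Du Dv cE c_gt0) mE -EFinM => -[].
have Mr : 0 < M `^ r by exact: powR_gt0.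
have cr : 0 < c `^ r by exact: powR_gt0.
rewrite powRN => eqS.
have {}eqS : M `^ r * (d u + d v) = m * c `^ r.
  have -> : d u + d v = (M `^ r)^-1 * m * c `^ r.
    by rewrite -eqS divfK// gt_eqF.
  by rewrite !mulrA divff ?mul1r// gt_eqF.
have m_gt0 : 0 < m.
  rewrite lt_neqAle m0 andbT; apply/eqP => m_0.
  move: eqS; rewrite -m_0 mul0r => /eqP.
  rewrite mulf_eq0 gt_eqF//= paddr_eq0// => /andP[/eqP du /eqP dv].
  case: (DD_pos_nonnull Duv) => n; case: n.
    exact: (fine_dirichlet_eq0 Du du).
  exact: (fine_dirichlet_eq0 Dv dv).
have := coupled_eq la0 mu0 r0 r1 (h_ge0 u) (h_ge0 v) m_gt0 (hm _ Du) (hm _ Dv)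
  c_gt0 cle.
rewrite eqS lexx => /(_ isT).
have ext w : D012 w -> 0 < h w -> d w = m * h w `^ r -> extremal_mu_s Omega s w.
  move=> Dw hw dw; have nw : ~ null Omega w.
    by move=> /(fine_hs_eq0 Dw) hw0; rewrite hw0 ltxx in hw.
  split=> //; rewrite mE (mu_quotientE Dw nw) dw mulfK// gt_eqF//.
  exact: powR_gt0.
case=> -[hw hz eM dE].
  exact: (or_introl (And3 eM (ext u Du hz dE) ((fine_hs_eq0 Dv).1 hw))).
exact: (or_intror (And3 eM ((fine_hs_eq0 Du).1 hw) (ext v Dv hz dE))).
Qed.

End minimization.

(** * The Nehari set *)

Section nehari.
Context (R : realType) (N : nat) (Omega : set 'rV[R]_N).
Context (s alpha beta lambda mu kappa : R).
Hypothesis (N3 : (3 <= N)%N) (oO : open Omega).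
Hypothesis (s0 : 0 < s) (s2 : s < 2).
Hypothesis (al1 : 1 < alpha) (be1 : 1 < beta) (albe : alpha + beta = crit N s).
Hypothesis (ka0 : kappa <= 0).

Local Notation p := (crit N s).
Local Notation r := (2 / crit N s).
Local Notation DD := (DD Omega).
Local Notation coupling := (coupling Omega s alpha beta lambda mu kappa).
Local Notation Phi := (Phi Omega s alpha beta lambda mu kappa).
Local Notation nehari := (nehari Omega s alpha beta lambda mu kappa).
Local Notation leb := (lebesgue_rV R N).

Let mO : measurable Omega := open_measurable_rV oO.
Let p2 : 2 < p := crit_gt2 N3 s2.
Let p0 : 0 < p. Proof. by apply: lt_trans p2; exact: ltr0n. Qed.

Let E (z : sob R N * sob R N) := fine (energy Omega z).
Let C (z : sob R N * sob R N) := fine (coupling z).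

Lemma energy_fin z : DD z -> energy Omega z = (E z)%:E.
Proof. by case: z => u v [Du Dv]; rewrite /E (energyE oO Du Dv). Qed.

Lemma coupling_fin z : DD z -> coupling z = (C z)%:E.
Proof.
case: z => u v [Du Dv]; rewrite /C.
by have [c [-> _]] := coupling_le lambda mu N3 oO s0 s2 al1 be1 albe ka0 Du Dv.
Qed.

Lemma DD_scale t z : DD z -> DD (t *: z).
Proof.
case: z => u v [Du Dv].
exact: (conj (D012_scale t oO Du) (D012_scale t oO Dv)).
Qed.

Lemma energy_scale t z : DD z -> E (t *: z) = t ^+ 2 * E z.
Proof.
move=> Dz; rewrite /E -[RHS]/(fine (t ^+ 2)%:E * fine (energy Omega z)) -fineM//; last first.
  by rewrite energy_fin.
case: z Dz => u v [Du Dv]; congr fine; rewrite /energy -ge0_integralZl_EFin ?sqr_ge0//.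
- apply: eq_integral => x _; rewrite -EFinM; congr EFin.
  rewrite mulrDr; congr (_ + _); exact: enorm_scale.
- by move=> x _; rewrite lee_fin addr_ge0 ?sqr_ge0.
- apply/measurable_EFinP; apply: measurable_funD; apply: measurable_enorm2.
    exact: D012_measurable2 Du.
  exact: D012_measurable2 Dv.
Qed.

Lemma coupling_scale t z : 0 <= t -> DD z -> C (t *: z) = t `^ p * C z.
Proof.
move=> t0 Dz; rewrite /C -[RHS]/(fine (t `^ p)%:E * fine (coupling z)) -fineM//; last first.
  by rewrite coupling_fin.
case: z Dz => u v [Du Dv]; congr fine; rewrite /coupling -integralZl//; last first.
  exact: coupling_integrable.
apply: eq_integral => x _; rewrite -EFinM; congr EFin.
have H (w : sob R N) q : `|(t *: w).1 x : R| `^ q = t `^ q * `|w.1 x : R| `^ q.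
  rewrite (_ : (t *: w).1 x = t * w.1 x)//.
  by rewrite normrM (ger0_norm t0) powRM.
rewrite -[(t *: (u, v)).1]/(t *: u) -[(t *: (u, v)).2]/(t *: v) !H /=.
have <- : t `^ alpha * t `^ beta = t `^ p.
  rewrite -albe; have [->|tN0] := eqVneq t 0.
    by rewrite !powR0 ?mul0r// gt_eqF// ?addr_gt0// (lt_trans ltr01).
  by rewrite powRD// tN0 implybT.
move: (t `^ alpha) (t `^ beta) (`|u.1 x : R| `^ p) (`|v.1 x : R| `^ p)
  (`|u.1 x : R| `^ alpha) (`|v.1 x : R| `^ beta) ((enorm x `^ s)^-1) => a1 a2 a3 a4 a5 a6 a7.
by ring.
Qed.

Lemma Phi_scale t z : 0 <= t -> DD z ->
  Phi (t *: z) = 2^-1 * (t ^+ 2 * E z) - p^-1 * (t `^ p * C z).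
Proof.
by move=> t0 Dz; rewrite -(energy_scale t Dz) -(coupling_scale t0 Dz).
Qed.

(** The derivative at t = 0 of Phi along the ray (1 + t) z, with e = E(z) and
    c = C(z). *)
Let is_derive_ray (e c : R) : is_derive (0 : R) (1 : R)
  (fun t : R => 2^-1 * ((1 + t) ^+ 2 * e) - p^-1 * ((1 + t) `^ p * c)) (e - c).
Proof.
pose g t : R := 1 + t.
have d1 : is_derive (0 : R) (1 : R) g 1.
  have -> : g = cst 1 + id by [].
  by apply: is_derive_eq; rewrite add0r.
have g0 : g 0 = 1 by rewrite /g addr0.
have d2 : is_derive (0 : R) (1 : R) (g ^+ 2) 2.
  by apply: is_derive_eq; rewrite expr1 g0 mulr1 [_ *: _]mulr1.
have d3 : is_derive (0 : R) (1 : R) ((@powR R ^~ p) \o g) p.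
  have g0_gt0 : 0 < g 0 by rewrite g0.
  have dp := is_derive1_powR p g0_gt0.
  by apply: is_derive_eq; rewrite g0 powR1 !mulr1.
have -> : (fun t : R => 2^-1 * ((1 + t) ^+ 2 * e) - p^-1 * ((1 + t) `^ p * c)) =
    ((2^-1 * e) *: (g ^+ 2 : R -> R)) - ((p^-1 * c) *: ((@powR R ^~ p) \o g)).
  apply/funext => t; transitivity (2^-1 * e * (g t ^+ 2) - p^-1 * c * (g t `^ p)).
    by congr (_ - _); rewrite -[RHS]mulrA; congr (_ * _); exact: mulrC.
  by rewrite -[RHS]/(2^-1 * e * (g ^+ 2) t - _) exprfctE.
apply: is_derive_eq; rewrite -![_ *: _]/(_ * _).
rewrite mulrAC mulVf ?mul1r// mulrAC mulVf ?mul1r// gt_eqF//.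
Qed.

(** The formula for Phi((1 + t) z) is valid for t > -1, hence near t = 0. *)
Lemma nehariE z : DD z -> ~ (null Omega z.1 /\ null Omega z.2) ->
  nehari z <-> E z = C z.
Proof.
move=> Dz nz.
have near_eq : \forall t \near (0 : R),
    2^-1 * ((1 + t) ^+ 2 * E z) - p^-1 * ((1 + t) `^ p * C z) = Phi (z + t *: z).
  have : \forall t \near (0 : R), ball (0 : R) 1 t by exact: nbhsx_ballx.
  apply: filterS => t; rewrite /ball/= sub0r normrN ltr_norml => /andP[t1 _].
 rewrite -{3}(scale1r z) -scalerDl Phi_scale//; lra.
split=> [[_ _ [_ d0]]|EC].
  have [_ d1] := is_derive_ray (E z) (C z).
  have := @near_eq_derive R R R _ _ 0 1 near_eq.
  by rewrite d1 d0 => /eqP; rewrite subr_eq0 => /eqP.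
have EC0 : E z - C z = 0 by rewrite EC subrr.
have dray := is_derive_ray (E z) (C z); rewrite EC0 in dray.
exact: (And3 Dz nz (near_eq_is_derive near_eq dray)).
Qed.

Lemma energy_gt0 z : DD z -> ~ (null Omega z.1 /\ null Omega z.2) -> 0 < E z.
Proof.
case: z => u v [Du Dv] nz; rewrite /E (energyE oO Du Dv) /=.
have du : 0 <= fine (dirichlet Omega u) by apply/fine_ge0/dirichlet_ge0.
have dv : 0 <= fine (dirichlet Omega v) by apply/fine_ge0/dirichlet_ge0.
rewrite lt_neqAle addr_ge0// andbT eq_sym; apply/eqP => /eqP.
rewrite paddr_eq0// => /andP[/eqP u0 /eqP v0]; apply: nz.
exact: (conj (fine_dirichlet_eq0 N3 oO Du u0) (fine_dirichlet_eq0 N3 oO Dv v0)).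
Qed.

Lemma null_scale t (u : sob R N) : t != 0 -> null Omega (t *: u) -> null Omega u.
Proof.
move=> t0; apply: filterS => x tux Ox; have /eqP := tux Ox.
by rewrite -[X in X == 0]/(t * u.1 x) mulf_eq0 (negbTE t0) => /eqP.
Qed.

Lemma DD_pos_gt0 z : DD_pos Omega s alpha beta lambda mu kappa z ->
  [/\ DD z, ~ (null Omega z.1 /\ null Omega z.2), 0 < E z & 0 < C z].
Proof.
case: z => u v Duv; have [Dz c0] := Duv.
have nz : ~ (null Omega u /\ null Omega v).
  move=> [nu nv].
  by case: (DD_pos_nonnull N3 oO s0 s2 al1 be1 albe ka0 Duv); apply.
split=> //; first exact: (energy_gt0 Dz nz).
by move: c0; rewrite (coupling_fin Dz) lte_fin.
Qed.

Lemma S_quotient_fineE z : DD z -> 0 < C z ->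
  S_quotient Omega s alpha beta lambda mu kappa z = (E z / C z `^ r)%:E.
Proof.
move=> Dz C0; rewrite /S_quotient (energy_fin Dz) (coupling_fin Dz) poweR_EFin.
by rewrite inver gt_eqF// powR_gt0.
Qed.

(** The multiple is t w with t^(p - 2) = E(w)/C(w).  As p r = 2, the quotient is
    invariant under scaling, and it is E^(1 - r) where E = C. *)
Lemma nehari_projection w : DD_pos Omega s alpha beta lambda mu kappa w ->
  exists t : R, [/\ 0 < t, nehari (t *: w) &
    E w / C w `^ r = (E (t *: w)) `^ (1 - r)].
Proof.
move=> wpos; have [Dw nw E0 C0] := DD_pos_gt0 wpos.
pose t := (E w / C w) `^ (p - 2)^-1.
have t0 : 0 < t by rewrite powR_gt0// divr_gt0.
have tp : t `^ p = t ^+ 2 * (E w / C w).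
  have -> : E w / C w = t `^ (p - 2).
    rewrite /t -powRrM mulVf ?powRr1 ?divr_ge0 ?(ltW E0) ?(ltW C0)//.
    by rewrite subr_eq0 gt_eqF.
  rewrite -powR_mulrn ?(ltW t0)// -powRD ?(gt_eqF t0) ?implybT//.
  by rewrite addrC subrK.
have Dtw := DD_scale t Dw.
have ntw : ~ (null Omega (t *: w).1 /\ null Omega (t *: w).2).
  move=> [n1 n2]; apply: nw.
  have tN0 : t != 0 by rewrite gt_eqF.
  exact: (conj (null_scale tN0 n1) (null_scale tN0 n2)).
have EC : E (t *: w) = C (t *: w).
  rewrite (energy_scale t Dw) (coupling_scale (ltW t0) Dw) tp.
  by rewrite -mulrA divfK// gt_eqF.
exists t; split; [exact: t0|exact: (nehariE Dtw ntw).2|].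
have T0 : 0 < E (t *: w) by exact: (energy_gt0 Dtw ntw).
have -> : E (t *: w) `^ (1 - r) = E (t *: w) / E (t *: w) `^ r.
  rewrite powRD ?(gt_eqF T0) ?implybT// powRr1 ?(ltW T0)//.
  by rewrite powRN.
rewrite {2}EC (energy_scale t Dw) (coupling_scale (ltW t0) Dw).
rewrite powRM ?powR_ge0 ?(ltW C0)// -powRrM.
have -> : p * r = 2 by rewrite mulrC divfK// gt_eqF.
rewrite powR_mulrn ?(ltW t0)// -[RHS]mulf_div.
by rewrite divff ?mul1r// expf_neq0// gt_eqF.
Qed.

Lemma ground_state_attained z :
  ground_state Omega s alpha beta lambda mu kappa z ->
  S_attained_at Omega s alpha beta lambda mu kappa z.
Proof.
move=> [nz zmin]; have [Dz nz' _] := nz.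
have EC := (nehariE Dz nz').1 nz.
have E0 := energy_gt0 Dz nz'.
have C0 : 0 < C z by rewrite -EC.
have zpos : DD_pos Omega s alpha beta lambda mu kappa z.
  by split=> //; rewrite (coupling_fin Dz) lte_fin.
split=> //; apply/eqP; rewrite eq_le; apply/andP; split; last first.
  by apply: ereal_inf_lbound; exists z.
apply/ereal_infP => _ [w wpos <-].
have [Dw nw Ew0 Cw0] := DD_pos_gt0 wpos.
have [t [t0 ntw Sw]] := nehari_projection wpos.
rewrite (S_quotient_fineE Dz C0) (S_quotient_fineE Dw Cw0) lee_fin Sw -EC.
have -> : E z / E z `^ r = E z `^ (1 - r).
  by rewrite powRD ?(gt_eqF E0) ?implybT// powRr1 ?(ltW E0)// powRN.
have r1 : r <= 1 by rewrite ler_pdivrMr// mul1r ltW.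
have [Dtw ntw' _] := ntw.
have ECt := (nehariE Dtw ntw').1 ntw.
have r1' : 0 <= 1 - r by rewrite subr_ge0.
have Tw0 := energy_gt0 Dtw ntw'.
apply: (ge0_ler_powR r1' (ltW E0) (ltW Tw0)).
have PhiE y : E y = C y -> Phi y = (2^-1 - p^-1) * E y.
  move=> ECy; rewrite -[LHS]/(2^-1 * E y - p^-1 * C y) -ECy.
  by rewrite mulrBl.
have := zmin _ ntw; rewrite (PhiE _ EC) (PhiE _ ECt).
by rewrite ler_pM2l// subr_gt0 ltf_pV2 ?posrE.
Qed.

End nehari.

Theorem lemma13 (R : realType) (N : nat) (Omega : set 'rV[R]_N)
    (s alpha beta lambda mu kappa : R) :
  (3 <= N)%N ->
  cone Omega \/ (domain Omega /\ ~ closure Omega 0) ->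
  0 < s -> s < 2 -> 1 < alpha -> 1 < beta -> alpha + beta = crit N s ->
  0 < lambda -> 0 < mu -> kappa <= 0 ->
  [/\ S_inf Omega s alpha beta lambda mu kappa =
        ((Num.max lambda mu `^ (- (2 / crit N s)))%:E * mu_s Omega s)%E,
      forall u v : sob R N,
        S_attained_at Omega s alpha beta lambda mu kappa (u, v) ->
        [/\ mu < lambda -> extremal_mu_s Omega s u /\ null Omega v,
            lambda < mu -> null Omega u /\ extremal_mu_s Omega s v &
            lambda = mu ->
              (extremal_mu_s Omega s u /\ null Omega v) \/
              (null Omega u /\ extremal_mu_s Omega s v)] &
      forall u v : sob R N,
        ground_state Omega s alpha beta lambda mu kappa (u, v) ->
        semi_trivial Omega (u, v)].
Proof.
move=> N3 hO s0 s2 al1 be1 albe la0 mu0 ka0.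
have oO : open Omega by case: hO => [[[]]|[[]]].
have attained u v : S_attained_at Omega s alpha beta lambda mu kappa (u, v) ->
    [/\ lambda = Num.max lambda mu, extremal_mu_s Omega s u & null Omega v] \/
    [/\ mu = Num.max lambda mu, null Omega u & extremal_mu_s Omega s v].
  exact: S_attained_cases.
have absurd_lt (a b : R) (P : Prop) : a <= b -> b < a -> P.
  by move=> ab; rewrite ltNge ab.
split; first exact: S_infE.
- move=> u v /attained [[lM eu nv]|[mM nu ev]].
  + have ml : mu <= lambda by rewrite lM le_max lexx orbT.
    by split=> [_| |_]; [split|exact: absurd_lt|left; split].
  + have lm : lambda <= mu by rewrite mM le_max lexx.
    by split=> [|_|_]; [exact: absurd_lt|split|right; split].
- move=> u v gs.
  have /attained : S_attained_at Omega s alpha beta lambda mu kappa (u, v).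
    exact: (ground_state_attained N3 oO s0 s2 al1 be1 albe ka0 gs).
  by case=> [[_ [_ nu _] nv]|[_ nu [_ nv _]]]; [left|right]; split.
Qed.
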